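(* (Nonsmooth Kurdyka-Łojasiewicz inequality) Let $\mathcal O$ be an o-minimal structure on $(\mathbb{R},+,\cdot)$, let $f:\mathbb{R}^n\to\mathbb{R}\cup\{+\infty\}$ be a lower semicontinuous function definable in $\mathcal O$, and let $U$ be a bounded definable subset of $\mathbb{R}^n$. There exist $\rho>0$ and a strictly increasing continuous definable function $\psi:[0,\rho)\to[0,+\infty)$ which is $C^1$ on $(0,\rho)$, with $\psi(0)=0$, and such that for all $x\in U$ with $0<|f(x)|<\rho$ and all $x^*\in\partial^\circ f(x)$ $$\|x^*\|\ \ge\ \frac{1}{\psi'(|f(x)|)}.$$
   Context: $\mathbb{R}^n$ carries its canonical scalar product. $\mathrm{dom}\,f=\{x: f(x)<+\infty\}$, $\mathrm{Graph}\,f=\{(x,f(x)):x\in\mathrm{dom}\,f\}\subset\mathbb{R}^{n}\times\mathbb{R}$; $f$ is lower semicontinuous if its epigraph $\{(x,\beta)\in\mathbb{R}^n\times\mathbb{R}:f(x)\le\beta\}$ is closed. Subdifferentials. For $x\in\mathrm{dom}\,f$, the Fréchet subdifferential $\hat\partial f(x)$ is the set of $x^*\in\mathbb{R}^n$ with $\liminf_{y\to x,\,y\ne x}\frac{f(y)-f(x)-\langle x^*,y-x\rangle}{\|y-x\|}\ge 0$. The limiting subdifferential $\partial f(x)$ is the set of $p$ for which there exist sequences $x_k$ and $x_k^*\in\hat\partial f(x_k)$ with $x_k\to x$, $f(x_k)\to f(x)$, $x_k^*\to p$. The asymptotic limiting subdifferential $\partial^\infty f(x)$ is the set of $q$ for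 which there exist $y_k$, $y_k^*\in\hat\partial f(y_k)$ and positive $t_k\searrow 0$ with $y_k\to x$, $f(y_k)\to f(x)$, $t_ky_k^*\to q$. The Clarke subdifferential is $\partial^\circ f(x)=\overline{\mathrm{co}}\,(\partial f(x)+\partial^\infty f(x))$ (closed convex hull of the Minkowski sum; it is empty if $\partial f(x)=\emptyset$). All these sets are empty if $x\notin\mathrm{dom}\,f$. O-minimality. An o-minimal structure on $(\mathbb{R},+,\cdot)$ is a sequence of Boolean algebras $\mathcal O_n$ of ''definable'' subsets of $\mathbb{R}^n$ such that for each $n$: (1) if $A\in\mathcal O_n$ then $A\times\mathbb{R}$ and $\mathbb{R}\times A$ are in $\mathcal O_{n+1}$; (2) if $A\in\mathcal O_{n+1}$ then its projection to the first $n$ coordinates is in $\mathcal O_n$; (3) $\mathcal O_n$ contains every set $\{x\in\mathbb{R}^n: P(x)=0\}$ with $P$ a polynomial; (4) the elements of $\mathcal O_1$ are exactly the finite unions of intervals and points. A function is definable if its graph is definable (for $f:\mathbb{R}^n\to\mathbb{R}\cup\{+\infty\}$, if $\mathrm{Graph}\,f\in\mathcal O_{n+1}$). *)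

(* Defs.v *)
From HB Require Import structures.
From mathcomp Require Import all_boot all_order all_algebra.
From mathcomp Require Import all_classical all_reals all_analysis.
(* Not imported: its notations clash with those of MathComp-Analysis. *)
From mathcomp Require mpoly.

Set Implicit Arguments.
Unset Strict Implicit.
Unset Printing Implicit Defensive.

Import Order.TTheory GRing.Theory Num.Theory.
Import numFieldNormedType.Exports.

Local Open Scope classical_set_scope.
Local Open Scope ring_scope.

(* R^n is 'rV[R]_n with its library topology, which is induced by the maximum
   norm `|x|; the canonical scalar product and the Euclidean norm are below. *)
Definition dotv (R : realType) (n : nat) (x y : 'rV[R]_n) : R :=
  \sum_(i < n) x 0 i * y 0 i.

Definition enorm (R : realType) (n : nat) (x : 'rV[R]_n) : R :=
  Num.sqrt (dotv x x).

(* O n is the Boolean algebra of definable subsets of R^n. R^n x R and R x R^n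
   are 'rV_(n + 1) and 'rV_(1 + n), through row_mx, lsubmx and rsubmx. The
   points in the description of O 1 are the degenerate intervals `[a, a]. *)
Record ominimal (R : realType) (O : forall n, set (set 'rV[R]_n)) : Prop :=
  Ominimal {
    ominimal_setT : forall n, O n setT ;
    ominimal_setU : forall n (A B : set 'rV[R]_n),
      O n A -> O n B -> O n (A `|` B) ;
    ominimal_setC : forall n (A : set 'rV[R]_n), O n A -> O n (~` A) ;
    ominimal_prodr : forall n (A : set 'rV[R]_n),
      O n A -> O (n + 1)%N [set z : 'rV[R]_(n + 1) | A (lsubmx z)] ;
    ominimal_prodl : forall n (A : set 'rV[R]_n),
      O n A -> O (1 + n)%N [set z : 'rV[R]_(1 + n) | A (rsubmx z)] ;
    ominimal_proj : forall n (A : set 'rV[R]_(n + 1)),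
      O (n + 1)%N A -> O n [set lsubmx z | z in A] ;
    ominimal_poly : forall n (P : mpoly.mpoly n R),
      O n [set x : 'rV[R]_n | mpoly.meval (fun i => x 0 i) P = 0] ;
    ominimal_line : forall A : set 'rV[R]_1,
      O 1%N A <-> exists s : seq (interval R),
        A = [set x : 'rV[R]_1 | exists2 I, I \in s & x 0 0 \in I]
  }.

Definition dom (R : realType) (n : nat) (f : 'rV[R]_n -> \bar R) :
    set 'rV[R]_n :=
  [set x | (f x < +oo)%E].

Definition egraph (R : realType) (n : nat) (f : 'rV[R]_n -> \bar R) :
    set 'rV[R]_(n + 1) :=
  [set row_mx x (fine (f x))%:M | x in dom f].

(* Graph of the restriction to D of a function of one real variable. *)
Definition graph_on (R : realType) (D : set R) (g : R -> R) :
    set 'rV[R]_(1 + 1) :=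
  [set row_mx t%:M (g t)%:M | t in D].

Definition epigraph (R : realType) (n : nat) (f : 'rV[R]_n -> \bar R) :
    set ('rV[R]_n * R) :=
  [set xb | (f xb.1 <= xb.2%:E)%E].

Definition lsc (R : realType) (n : nat) (f : 'rV[R]_n -> \bar R) : Prop :=
  closed (epigraph f).

Definition frechet_subdiff (R : realType) (n : nat) (f : 'rV[R]_n -> \bar R)
    (x : 'rV[R]_n) : set 'rV[R]_n :=
  [set p | dom f x /\
    (0 <= limf_einf (fun y : 'rV[R]_n => (f y - f x - (dotv p (y - x))%:E)
                              * ((enorm (y - x))^-1)%:E) x^')%E].

Definition limiting_subdiff (R : realType) (n : nat) (f : 'rV[R]_n -> \bar R)
    (x : 'rV[R]_n) : set 'rV[R]_n :=
  [set p | dom f x /\ exists u us : nat -> 'rV[R]_n,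
    [/\ forall k, frechet_subdiff f (u k) (us k),
        u @ \oo --> x,
        (fun k => f (u k)) @ \oo --> f x &
        us @ \oo --> p]].

Definition asymptotic_subdiff (R : realType) (n : nat) (f : 'rV[R]_n -> \bar R)
    (x : 'rV[R]_n) : set 'rV[R]_n :=
  [set q | dom f x /\ exists (u us : nat -> 'rV[R]_n) (t : nat -> R),
    [/\ forall k, frechet_subdiff f (u k) (us k),
        [/\ forall k, 0 < t k, nonincreasing_seq t & t @ \oo --> 0],
        u @ \oo --> x,
        (fun k => f (u k)) @ \oo --> f x &
        (fun k => t k *: us k) @ \oo --> q]].

Definition convex_hull (R : realType) (n : nat) (A : set 'rV[R]_n) :
    set 'rV[R]_n :=
  smallest (@convex_set R 'rV[R]_n) A.

Definition clarke_subdiff (R : realType) (n : nat) (f : 'rV[R]_n -> \bar R)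
    (x : 'rV[R]_n) : set 'rV[R]_n :=
  closure (convex_hull
    [set p + q | p in limiting_subdiff f x & q in asymptotic_subdiff f x]).

(* Main.v *)
Require Import Defs.
From mathcomp Require Import all_boot all_order all_algebra.
From mathcomp Require Import all_classical all_reals all_analysis.
From mathcomp Require mpoly.
Import (canonicals) mpoly.
From mathcomp Require Import ring lra.

Set Implicit Arguments.
Unset Strict Implicit.
Unset Printing Implicit Defensive.

Import Order.TTheory GRing.Theory Num.Theory.
Import numFieldNormedType.Exports.

Local Open Scope classical_set_scope.
Local Open Scope ring_scope.

(** The inequality is proved along curves, where it follows from o-minimality
    of subsets of the line.

    Put z = (x, f x) and let G be the graph of f. If p is a Frechet
    subgradient at x, then every positive multiple of (p, -1) is a Frechet
    normal to the set G at z. Limits of such vectors give, for every Clarke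
    subgradient p at x, that (p, -1) lies in the linear span of the limiting
    normals to G at z ([clarke_span]).

    The heart of the proof is that a definable curve z in G satisfies, for
    all t outside a set without interior, <nu, z'(t)> = 0 for every limiting
    normal nu to G at z(t) ([limiting_normal_curve]). For Frechet normals
    this is one line of calculus. For a limiting normal nu(t), definable
    choice yields base points w(t, s) in G and Frechet normals nu(t, s)
    there, both at distance less than s from z(t) and nu(t). For fixed s the
    curve w(., s) lies in G, so <nu(t, s), w'(t, s)> = 0, and one would like
    w'(t, s) to tend to z'(t). It does for most t: a definable family bounded
    by s whose slope stayed away from 0 for all small s would grow by a fixed
    amount on a fixed interval ([dense_in_small_calm]).

    Now choose definably, for each small t > 0, a point x(t) of U with
    |f(x(t))| = t and a p(t) as above whose norm is minimal up to a factor 2.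
    Orthogonality of (p(t), -1) and z'(t) says <p(t), x'(t)> = +1 or -1,
    hence 1 <= |p(t)| |z'(t)|. The coordinates of z are bounded and
    eventually monotone, so |z'| is, in the l1 norm, the derivative of a
    bounded definable function phi ([talweg]), and psi(t) = t + 2 (phi(t) -
    inf phi) has all the required properties ([desingularize]).

    The o-minimal tools needed are for functions of one real variable. Over
    the reals they have short proofs, because an interval covered by
    countably many definable sets has a subinterval inside one of them
    ([itv_countable_cover]): such a set is a finite union of intervals, hence
    is finite or has interior, and an interval is uncountable. From this
    follow the continuity and strict differentiability of definable functions
    outside sets without interior ([dense_in_strict_derive]), and the fact
    that a property which holds for each t and all small s holds on a box
    ([ev_right_uniform]). *)

(* Closure lemmas find the structure by instance search, which lets the tactic
   below apply them without naming it. *)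
Existing Class ominimal.

(** * Definable sets, functions and maps *)
Section Definability.
Variables (R : realType) (O : forall n : nat, set (set 'rV[R]_n)).
Context {ominO : ominimal O}.

Definition definable N (P : 'rV[R]_N -> Prop) : Prop := O P.

Lemma definable_ext N (P Q : 'rV[R]_N -> Prop) :
  (forall e, P e <-> Q e) -> definable P -> definable Q.
Proof.
move=> PQ; rewrite /definable; suff -> : P = Q by [].
by apply/funext => e; apply/propext.
Qed.

Lemma definable_not N (P : 'rV[R]_N -> Prop) : definable P ->
    definable (fun e => ~ P e).
Proof. by move=> HP; exact: (ominimal_setC ominO HP). Qed.

Lemma definable_or N (P Q : 'rV[R]_N -> Prop) :
  definable P -> definable Q -> definable (fun e => P e \/ Q e).
Proof. by move=> HP HQ; exact: (ominimal_setU ominO HP HQ). Qed.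

Lemma definable_and N (P Q : 'rV[R]_N -> Prop) :
  definable P -> definable Q -> definable (fun e => P e /\ Q e).
Proof.
move=> HP HQ; have := definable_not (definable_or (definable_not HP)
    (definable_not HQ)).
by apply: definable_ext => e; split=>
    [/not_orP[/contrapT ? /contrapT]|[? ?] []].
Qed.

Lemma definable_imp N (P Q : 'rV[R]_N -> Prop) :
  definable P -> definable Q -> definable (fun e => P e -> Q e).
Proof.
move=> HP HQ; have := definable_or (definable_not HP) HQ.
apply: definable_ext => e; split=> [[nP /nP|//]//|PQ].
by have [/PQ|] := pselect (P e); [right|left].
Qed.

Lemma definable_const N (P : Prop) : definable (fun _ : 'rV[R]_N => P).
Proof.
have HT := ominimal_setT ominO N.
have [p|np] := pselect P; first by apply: definable_ext HT => e; split.
by apply: definable_ext (definable_not HT) => e; split=> // /(_ I).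
Qed.

(** Needed because the dimensions n + k.+1 and n + k + 1 are equal but not
    convertible. *)
Lemma definable_cast N M (eNM : N = M) (P : 'rV[R]_N -> Prop) :
  definable P -> definable (fun e : 'rV[R]_M => P (castmx (erefl, esym eNM) e)).
Proof. by case: M / eNM; apply: definable_ext => e; rewrite castmx_id. Qed.

Lemma definable_padl k N (P : 'rV[R]_N -> Prop) :
  definable P -> definable (fun e : 'rV[R]_(k + N) => P (rsubmx e)).
Proof.
elim: k => [|k IHk] HP.
  apply: definable_ext HP => e.
  rewrite (_ : rsubmx (e : 'rV[R]_(0 + N)) = (e : 'rV[R]_N)) //.
  by apply/rowP => i; rewrite mxE; congr (e _ _); apply/val_inj.
have := ominimal_prodl ominO (IHk HP); apply: definable_ext => e /=.
rewrite (_ : rsubmx _ = rsubmx (e : 'rV_(k.+1 + N))) //.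
by apply/rowP => i; rewrite !mxE; congr (e _ _); apply/val_inj.
Qed.

(** The quantified vector is removed one coordinate at a time, the last one
    first, since the axioms only project out a single last coordinate. *)
Lemma definable_exists k N (P : 'rV[R]_N -> 'rV[R]_k -> Prop) :
  definable (fun e : 'rV[R]_(N + k) => P (lsubmx e) (rsubmx e)) ->
  definable (fun e => exists y, P e y).
Proof.
elim: k N P => [|k IHk] N P HP.
  have := definable_cast (addn0 N) HP; apply: definable_ext => e.
  rewrite (_ : lsubmx _ = e); last first.
    by apply/rowP => i; rewrite mxE castmxE /=; congr (e _ _); apply/val_inj.
  split=> [|[y]]; first by exists (rsubmx (castmx (erefl, esym (addn0 N)) e)).
  by rewrite (thinmx0 y) [rsubmx _]thinmx0.
have eN : (N + k.+1 = N + k + 1)%N by rewrite addnS addn1.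
have := ominimal_proj ominO (definable_cast eN HP) => HQ.
(* Q keeps the first k coordinates of the vector free and quantifies the
   last. *)
pose Q (e : 'rV[R]_N) (y : 'rV[R]_k) : Prop := exists c : R, 
  P e (\row_(i < k.+1) match unlift ord_max i with Some j => y 0 j | None =>
      c end).
apply: (@definable_ext _ (fun e => exists y, Q e y)); last first.
  apply: IHk; apply: definable_ext HQ => e; split.
    case=> z Pz <-; exists (z 0 (rshift _ 0)).
    have El : lsubmx (lsubmx z) = lsubmx (castmx (erefl 1%N, esym eN) z).
      apply/rowP => i; rewrite !mxE castmxE /=.
      by congr (z _ _); apply/val_inj.
    have Er : (\row_i match unlift ord_max i with
               | Some j => (rsubmx (lsubmx z)) 0 j | None =>
                   z 0 (rshift (N + k) 0) end)
         = rsubmx (castmx (erefl 1%N, esym eN) z).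
      apply/rowP => i; rewrite !mxE castmxE /=; case: unliftP => [j|] ->.
        rewrite !mxE; congr (z _ _); apply/val_inj => //=.
        by rewrite /bump leqNgt ltn_ord.
      by congr (z _ _); apply/val_inj; rewrite //= addn0.
    by rewrite Er El.
  case=> c Pc; exists (row_mx e c%:M); last by rewrite row_mxKl.
  rewrite /mkset.
  have El : lsubmx (castmx (erefl 1%N, esym eN) (row_mx e c%:M)) = lsubmx e.
    apply/rowP => i; rewrite !mxE castmxE /=.
    have -> : cast_ord (esym (esym eN)) (lshift k.+1 i) = lshift 1 (lshift k i).
      exact/val_inj.
    by rewrite row_mxEl cast_ord_id.
  have Er : rsubmx (castmx (erefl 1%N, esym eN) (row_mx e c%:M)) =
     (\row_i match unlift ord_max i with
               | Some j => (rsubmx e) 0 j | None => c end).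
    apply/rowP => i; rewrite !mxE castmxE /=; case: unliftP => [j|] ->.
      have -> : cast_ord (esym (esym eN)) (rshift N (lift ord_max j)) =
                lshift 1 (rshift N j).
        by apply/val_inj; rewrite /= /bump leqNgt ltn_ord.
      by rewrite row_mxEl !mxE cast_ord_id.
    have -> : cast_ord (esym (esym eN)) (rshift N ord_max) = rshift (N + k) 0.
      by apply/val_inj; rewrite /= addn0.
    by rewrite row_mxEr mxE !ord1 eqxx.
  by rewrite El Er.
move=> e; split=> [[y [c]]|[y Py]];
    first by exists (\row_(i < k.+1) match unlift ord_max i with
               | Some j => y 0 j | None => c end).
exists (\row_(i < k) y 0 (lift ord_max i)); exists (y 0 ord_max).
congr (P e _): Py; apply/rowP => i; rewrite mxE; case: unliftP => [j|] -> //.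
by rewrite mxE.
Qed.

Lemma definable_forall k N (P : 'rV[R]_N -> 'rV[R]_k -> Prop) :
  definable (fun e : 'rV[R]_(N + k) => P (lsubmx e) (rsubmx e)) ->
  definable (fun e => forall y, P e y).
Proof.
move=> HP; have := definable_not (@definable_exists k N (fun e y =>
    ~ P e y) (definable_not HP)).
apply: definable_ext => e; split=> [H y|H [y]].
  by apply: contrapT => nP; apply: H; exists y.
by apply; exact: H.
Qed.

Lemma row_const (y : 'rV[R]_1) : y = (y 0 0)%:M.
Proof. by apply/rowP => i; rewrite ord1 !mxE eqxx mulr1n. Qed.

Lemma definable_existsR N (P : 'rV[R]_N -> R -> Prop) :
  definable (fun e : 'rV[R]_(N + 1) => P (lsubmx e) (rsubmx e 0 0)) ->
  definable (fun e => exists y, P e y).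
Proof.
move=> /(@definable_exists 1 N (fun e y => P e (y 0 0)));
    apply: definable_ext => e.
by split=> [[y]|[y]]; [exists (y 0 0)|exists y%:M; rewrite mxE eqxx].
Qed.

Lemma definable_forallR N (P : 'rV[R]_N -> R -> Prop) :
  definable (fun e : 'rV[R]_(N + 1) => P (lsubmx e) (rsubmx e 0 0)) ->
  definable (fun e => forall y, P e y).
Proof.
move=> /(@definable_forall 1 N (fun e y => P e (y 0 0)));
    apply: definable_ext => e.
by split=> H y; [have := H y%:M; rewrite mxE eqxx|exact: H].
Qed.

Lemma definable_forall_ord k N (P : 'rV[R]_N -> 'I_k -> Prop) :
  (forall i, definable (P ^~ i)) -> definable (fun e => forall i, P e i).
Proof.
elim: k P => [|k IHk] P HP.
  by apply: definable_ext (definable_const N True) => e; split=> // _ [].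
have := definable_and (HP ord0) (IHk (fun e i => P e (lift ord0 i)) (fun i =>
    HP _)).
apply: definable_ext => e; split=> [[P0 Pi] i|H]; last by split.
by case: (unliftP ord0 i) => [j|] ->.
Qed.

Lemma definable_poly0 N (F : 'rV[R]_N -> R) (P : mpoly.mpoly N R) :
  (forall e : 'rV[R]_N, mpoly.meval (fun i => e 0 i) P = F e) ->
      definable (fun e => F e = 0).
Proof.
move=> PF; have := ominimal_poly ominO P; apply: definable_ext => e /=.
by rewrite PF.
Qed.

Lemma definable_coord_eq N (i j : 'I_N) : definable (fun e : 'rV[R]_N =>
    e 0 i = e 0 j).
Proof.
apply: (@definable_ext _ (fun e : 'rV[R]_N => e 0 i - e 0 j = 0)).
  by move=> e; split=> [/eqP|->]; [rewrite subr_eq0 => /eqP|rewrite subrr].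
refine (@definable_poly0 _ (fun e : 'rV[R]_N =>
    e 0 i - e 0 j) (mpoly.mpolyX R (mpoly.mnm1 i) - mpoly.mpolyX R (mpoly.mnm1
    j)) _).
by move=> e; rewrite mpoly.mevalB !mpoly.mevalXU.
Qed.

(** The right-hand vector is the y in P with y_i = e_(s i), and this graph of a
    coordinate selection is cut out by linear equations. *)
Lemma definable_reindex N M (s : 'I_N -> 'I_M) (P : 'rV[R]_N -> Prop) :
  definable P -> definable (fun e => P (\row_i e 0 (s i))).
Proof.
move=> HP.
apply: (@definable_ext _ (fun e => exists y, P y /\ forall i,
    y 0 i = e 0 (s i))).
  move=> e; split=> [[y [Py ye]]|PP].
    by congr (P _): Py; apply/rowP => i; rewrite mxE.
  by eexists; split; [exact: PP|move=> i; rewrite mxE].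
apply: definable_exists; apply: definable_and; first exact: definable_padl.
apply: definable_forall_ord => i.
apply: definable_ext (@definable_coord_eq (M + N) (rshift M i) (lshift N (s
    i))) => e.
by rewrite !mxE.
Qed.

Definition definable_fun N (F : 'rV[R]_N -> R) : Prop :=
  definable (fun e : 'rV[R]_(N + 1) => F (lsubmx e) = rsubmx e 0 0).

(** Coordinatewise definability is what the closure lemmas produce, and it is
    equivalent to definability of the graph in dimension N + k. *)
Definition definable_map N k (F : 'rV[R]_N -> 'rV[R]_k) : Prop :=
  forall i, definable_fun (fun e => F e 0 i).

Lemma definable_subst N k (F : 'rV[R]_N -> 'rV[R]_k) (P : 'rV[R]_k -> Prop) :
  definable P -> definable_map F -> definable (fun e => P (F e)).
Proof.
move=> HP HF.
apply: (@definable_ext _ (fun e => exists y, P y /\ forall i, F e 0 i = y 0 i)).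
  move=> e; split=> [[y [Py ye]]|PP]; last by exists (F e).
  by congr (P _): Py; apply/rowP => i; rewrite ye.
apply: definable_exists; apply: definable_and; first exact: definable_padl.
apply: definable_forall_ord => i.
pose s (j : 'I_(N + 1)) : 'I_(N + k) :=
  match fintype.split j with inl a => lshift k a | inr _ => rshift N i end.
have := @definable_reindex _ _ s _ (HF i); apply: definable_ext => e.
rewrite (_ : lsubmx (\row_j (e : 'rV[R]_(N + k)) 0 (s j)) = lsubmx e);
    last first.
  apply/rowP => j; rewrite !mxE /s; case: fintype.splitP => /= a.
    by move=> E; congr (e _ _); apply/val_inj.
  by move=> E; have := ltn_ord j; rewrite E ltnNge leq_addr.
rewrite (_ : rsubmx (\row_j (e : 'rV[R]_(N + k)) 0 (s j)) 0 0 = rsubmx e 0 i)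
    // !mxE /s.
case: fintype.splitP => /= a // E; have := ltn_ord a.
by rewrite -E ltnNge leq_addr.
Qed.

Lemma dfun_ext N (F G : 'rV[R]_N -> R) : F =1 G -> definable_fun F ->
    definable_fun G.
Proof. by move=> /funext ->. Qed.

Lemma dfun_coord N (i : 'I_N) : definable_fun (fun e : 'rV[R]_N => e 0 i).
Proof.
apply: definable_ext (@definable_coord_eq (N + 1) (lshift 1 i) (rshift N 0)) =>
    e.
by rewrite !mxE.
Qed.

Lemma dfun_lsub N n k (F : 'rV[R]_N -> 'rV[R]_(n + k)) i :
  definable_fun (fun e => F e 0 (lshift k i)) -> definable_fun (fun e =>
      lsubmx (F e) 0 i).
Proof. by apply: dfun_ext => e; rewrite mxE. Qed.

Lemma dfun_rsub N n k (F : 'rV[R]_N -> 'rV[R]_(n + k)) i :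
  definable_fun (fun e => F e 0 (rshift n i)) -> definable_fun (fun e =>
      rsubmx (F e) 0 i).
Proof. by apply: dfun_ext => e; rewrite mxE. Qed.

Lemma dmap_row N n k (F : 'rV[R]_N -> 'rV[R]_n) (G : 'rV[R]_N -> 'rV[R]_k) :
  definable_map F -> definable_map G -> definable_map (fun e =>
      row_mx (F e) (G e)).
Proof.
move=> HF HG i; case: (fintype.splitP i) => a ia.
  apply: dfun_ext (HF a) => e; rewrite -(row_mxEl (F e) (G e)).
  by congr (row_mx _ _ _ _); apply/val_inj.
apply: dfun_ext (HG a) => e; rewrite -(row_mxEr (F e) (G e)).
by congr (row_mx _ _ _ _); apply/val_inj.
Qed.

Lemma dmap_scalar N (F : 'rV[R]_N -> R) :
  definable_fun F -> definable_map (fun e => (F e)%:M : 'rV_1).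
Proof. by move=> HF i; apply: dfun_ext HF => e; rewrite ord1 mxE eqxx. Qed.

Lemma dmap_id N : definable_map (fun e : 'rV[R]_N => e).
Proof. by move=> i; exact: dfun_coord. Qed.

Lemma dmap_lsub N n k (F : 'rV[R]_N -> 'rV[R]_(n + k)) :
  definable_map F -> definable_map (fun e => lsubmx (F e)).
Proof. by move=> HF i; apply: dfun_lsub. Qed.

Lemma dmap_rsub N n k (F : 'rV[R]_N -> 'rV[R]_(n + k)) :
  definable_map F -> definable_map (fun e => rsubmx (F e)).
Proof. by move=> HF i; apply: dfun_rsub. Qed.

Lemma definable_eq N (F G : 'rV[R]_N -> R) :
  definable_fun F -> definable_fun G -> definable (fun e => F e = G e).
Proof.
move=> HF HG.
have := definable_subst HF (dmap_row (@dmap_id N) (dmap_scalar HG)).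
by apply: definable_ext => e; rewrite row_mxKl row_mxKr mxE eqxx.
Qed.

Lemma dfun_comp N k (F : 'rV[R]_N -> 'rV[R]_k) (g : 'rV[R]_k -> R) :
  definable_fun g -> definable_map F -> definable_fun (fun e => g (F e)).
Proof.
move=> Hg HF.
have HF' : definable_map (fun e : 'rV[R]_(N + 1) => F (lsubmx e)).
  move=> i; rewrite /definable_fun.
  have Hr := dmap_row (dmap_lsub (dmap_lsub (@dmap_id (N + 1 + 1))))
                  (dmap_rsub (@dmap_id (N + 1 + 1))).
  have := definable_subst (HF i) Hr; apply: definable_ext => e.
  by rewrite row_mxKl row_mxKr.
have := definable_subst Hg (dmap_row HF' (dmap_rsub (@dmap_id (N + 1)))).
by apply: definable_ext => e; rewrite row_mxKl row_mxKr.
Qed.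

Lemma dfun_const N c : definable_fun (fun _ : 'rV[R]_N => c).
Proof.
pose i : 'I_(N + 1) := rshift N 0.
apply: (@definable_ext _ (fun e : 'rV[R]_(N + 1) => e 0 i - c = 0)).
  move=> e; rewrite mxE; split=> [/eqP|->]; rewrite ?subrr //.
  by rewrite subr_eq0 => /eqP.
apply: (@definable_poly0 _ _ (mpoly.mpolyX R (mpoly.mnm1 i) - mpoly.mpolyC _
    c)).
by move=> e; rewrite mpoly.mevalB mpoly.mevalXU mpoly.mevalC.
Qed.

(** Reduces a binary operation to the definability of its graph in dimension
    3. *)
Lemma dfun_op2 N (op : R -> R -> R) (F G : 'rV[R]_N -> R) :
  definable_fun (fun e : 'rV[R]_2 => op (e 0 0) (e 0 1)) -> definable_fun F ->
      definable_fun G ->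
  definable_fun (fun e => op (F e) (G e)).
Proof.
move=> Hop HF HG.
have HV : definable_map (fun e => \row_(i < 2) if i == 0 then F e else G e).
  move=> i; case: (eqVneq i 0) => [->|i0].
    by apply: dfun_ext HF => e; rewrite mxE.
  by apply: dfun_ext HG => e; rewrite mxE (negPf i0).
by apply: dfun_ext (dfun_comp Hop HV) => e; rewrite !mxE.
Qed.

Lemma dfun_add N (F G : 'rV[R]_N -> R) :
  definable_fun F -> definable_fun G -> definable_fun (fun e => F e + G e).
Proof.
apply: dfun_op2; pose x k : mpoly.mpoly (2 + 1) R :=
    mpoly.mpolyX R (mpoly.mnm1 k).
apply: (@definable_ext _ (fun e : 'rV[R]_(2 + 1) =>
    e 0 (lshift 1 0) + e 0 (lshift 1 1) - e 0 (rshift 2 0) = 0)).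
  move=> e; rewrite !mxE; split=> [/eqP|->]; rewrite ?subrr //.
  by rewrite subr_eq0 => /eqP.
apply: (@definable_poly0 _ _ (x (lshift 1 0) + x (lshift 1 1) - x (rshift 2
    0))).
by move=> e; rewrite mpoly.mevalB mpoly.mevalD !mpoly.mevalXU.
Qed.

Lemma dfun_mul N (F G : 'rV[R]_N -> R) :
  definable_fun F -> definable_fun G -> definable_fun (fun e => F e * G e).
Proof.
apply: dfun_op2; pose x k : mpoly.mpoly (2 + 1) R :=
    mpoly.mpolyX R (mpoly.mnm1 k).
apply: (@definable_ext _ (fun e : 'rV[R]_(2 + 1) =>
    e 0 (lshift 1 0) * e 0 (lshift 1 1) - e 0 (rshift 2 0) = 0)).
  move=> e; rewrite !mxE; split=> [/eqP|->]; rewrite ?subrr //.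
  by rewrite subr_eq0 => /eqP.
apply: (@definable_poly0 _ _ (x (lshift 1 0) * x (lshift 1 1) - x (rshift 2
    0))).
by move=> e; rewrite mpoly.mevalB mpoly.mevalM !mpoly.mevalXU.
Qed.

Lemma dfun_opp N (F : 'rV[R]_N -> R) : definable_fun F ->
    definable_fun (fun e => - F e).
Proof.
move=> HF; have := dfun_mul (dfun_const N (-1)) HF.
by apply: dfun_ext => e; rewrite mulN1r.
Qed.

Lemma dfun_sum N k (F : 'rV[R]_N -> 'I_k -> R) :
  (forall i, definable_fun (F ^~ i)) -> definable_fun (fun e =>
      \sum_(i < k) F e i).
Proof.
elim: k F => [|k IHk] F HF.
  by apply: dfun_ext (dfun_const N 0) => e; rewrite big_ord0.
apply: (@dfun_ext _ (fun e => \sum_(i < k) F e (widen_ord (leqnSn k) i) + F e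
    ord_max)).
  by move=> e; rewrite big_ord_recr.
by apply: dfun_add => //; exact: IHk.
Qed.

(** An inequality of reals is the existence of a square root of the
    difference. *)
Lemma definable_le N (F G : 'rV[R]_N -> R) :
  definable_fun F -> definable_fun G -> definable (fun e => F e <= G e).
Proof.
move=> HF HG.
apply: (@definable_ext _ (fun e => exists u : R, G e - F e = u * u)).
  move=> e; rewrite -subr_ge0; split=> [[u ->]|h];
      first by rewrite -expr2 sqr_ge0.
  by exists (Num.sqrt (G e - F e)); rewrite -expr2 sqr_sqrtr.
have HL : definable_map (fun e : 'rV[R]_(N + 1) =>
    lsubmx e) by apply/dmap_lsub/dmap_id.
apply: definable_existsR; apply: definable_eq.
  by apply: dfun_add; [|apply: dfun_opp]; apply: dfun_comp.
by apply: dfun_mul; apply: (dmap_rsub (@dmap_id _)).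
Qed.

Lemma definable_lt N (F G : 'rV[R]_N -> R) :
  definable_fun F -> definable_fun G -> definable (fun e => F e < G e).
Proof.
move=> HF HG; apply: definable_ext (definable_not (definable_le HG HF)) => e.
by rewrite ltNge; split=> /negP.
Qed.

Lemma dfun_if N (P : 'rV[R]_N -> Prop) (F G : 'rV[R]_N -> R) :
  definable P -> definable_fun F -> definable_fun G -> definable_fun (fun e =>
      if `[< P e >] then F e else G e).
Proof.
move=> HP HF HG.
have HL : definable_map (fun e : 'rV[R]_(N + 1) =>
    lsubmx e) by apply/dmap_lsub/dmap_id.
have HP' := definable_subst HP HL.
have := definable_or (definable_and HP' HF) (definable_and (definable_not HP')
    HG).
apply: definable_ext => e; case: asboolP => h.
  by split=> [[[]//|[]//]|]; left.
by split=> [[[]//|[]//]|]; right.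
Qed.

Lemma dfun_norm N (F : 'rV[R]_N -> R) : definable_fun F ->
    definable_fun (fun e => `|F e|).
Proof.
move=> HF; have := dfun_if (definable_le (dfun_const N 0) HF) HF (dfun_opp HF).
apply: dfun_ext => e; case: asboolP => [|/negP].
  by move=> /ger0_norm.
by rewrite -ltNge => /ltr0_norm.
Qed.

Lemma dfun_row N n k (F : 'rV[R]_N -> 'rV[R]_n) (G : 'rV[R]_N -> 'rV[R]_k) i :
  definable_map F -> definable_map G -> definable_fun (fun e =>
      row_mx (F e) (G e) 0 i).
Proof. by move=> HF HG; exact: (dmap_row HF HG). Qed.

Lemma dfun_scalar_mx N (F : 'rV[R]_N -> R) (i : 'I_1) :
  definable_fun F -> definable_fun (fun e => ((F e)%:M : 'rV_1) 0 i).
Proof. by move=> HF; exact: (dmap_scalar HF). Qed.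

Lemma dfun_addv N k (F G : 'rV[R]_N -> 'rV[R]_k) i :
  definable_fun (fun e => F e 0 i) -> definable_fun (fun e => G e 0 i) ->
  definable_fun (fun e => (F e + G e) 0 i).
Proof. by move=> HF HG; apply: dfun_ext (dfun_add HF HG) => e; rewrite mxE. Qed.

Lemma dfun_oppv N k (F : 'rV[R]_N -> 'rV[R]_k) i :
  definable_fun (fun e => F e 0 i) -> definable_fun (fun e => (- F e) 0 i).
Proof. by move=> HF; apply: dfun_ext (dfun_opp HF) => e; rewrite mxE. Qed.

Lemma dfun_vcomp N n k (F : 'rV[R]_N -> 'rV[R]_k) (E : 'rV[R]_n -> 'rV[R]_N) i :
  definable_map F -> definable_map E -> definable_fun (fun e => F (E e) 0 i).
Proof. by move=> HF HE; exact: (dfun_comp (HF i) HE). Qed.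

Lemma dfun_dotv N k (F G : 'rV[R]_N -> 'rV[R]_k) :
  definable_map F -> definable_map G -> definable_fun (fun e =>
      dotv (F e) (G e)).
Proof. by move=> HF HG; apply: dfun_sum => i; apply: dfun_mul. Qed.

Lemma dfun_exp N (F : 'rV[R]_N -> R) n : definable_fun F ->
    definable_fun (fun e => F e ^+ n).
Proof.
move=> HF; elim: n => [|n IHn].
  by apply: dfun_ext (dfun_const N 1) => e; rewrite expr0.
by apply: dfun_ext (dfun_mul HF IHn) => e; rewrite exprS.
Qed.

Definition definable1 (A : R -> Prop) := definable (fun e : 'rV[R]_1 =>
    A (e 0 0)).
Definition definable2 (A : R -> R -> Prop) :=
  definable (fun e : 'rV[R]_2 => A (e 0 0) (e 0 1)).
Definition definable_fun1 (g : R -> R) := definable_fun (fun e : 'rV[R]_1 =>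
    g (e 0 0)).
Definition definable_fun2 (g : R -> R -> R) :=
  definable_fun (fun e : 'rV[R]_2 => g (e 0 0) (e 0 1)).
Definition definable_curve m (z : R -> 'rV[R]_m) := forall i,
    definable_fun1 (fun t => z t 0 i).
Definition definable_surface m (z : R -> R -> 'rV[R]_m) :=
  forall i, definable_fun2 (fun t s => z t s 0 i).

Lemma dmap_pair N (F G : 'rV[R]_N -> R) :
  definable_fun F -> definable_fun G -> definable_map (fun e =>
      \row_(i < 2) if i == 0 then F e else G e).
Proof.
move=> HF HG i; case: (eqVneq i 0) => [->|i0].
  by apply: dfun_ext HF => e; rewrite mxE.
by apply: dfun_ext HG => e; rewrite mxE (negPf i0).
Qed.

Lemma definable1_comp N (A : R -> Prop) (F : 'rV[R]_N -> R) :
  definable1 A -> definable_fun F -> definable (fun e => A (F e)).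
Proof.
move=> HA HF; have := definable_subst HA (dmap_scalar HF).
by apply: definable_ext => e; rewrite mxE eqxx.
Qed.

Lemma definable2_comp N (A : R -> R -> Prop) (F G : 'rV[R]_N -> R) :
  definable2 A -> definable_fun F -> definable_fun G -> definable (fun e =>
      A (F e) (G e)).
Proof.
move=> HA HF HG; have := definable_subst HA (dmap_pair HF HG).
by apply: definable_ext => e; rewrite !mxE.
Qed.

Lemma definable_fun1_comp N (g : R -> R) (F : 'rV[R]_N -> R) :
  definable_fun1 g -> definable_fun F -> definable_fun (fun e => g (F e)).
Proof.
move=> Hg HF; have := dfun_comp Hg (dmap_scalar HF).
by apply: dfun_ext => e; rewrite mxE eqxx.
Qed.

Lemma definable_fun2_comp N (g : R -> R -> R) (F G : 'rV[R]_N -> R) :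
  definable_fun2 g -> definable_fun F -> definable_fun G ->
      definable_fun (fun e => g (F e) (G e)).
Proof. exact: dfun_op2. Qed.

Lemma definable_curve_comp N m (z : R -> 'rV[R]_m) (F : 'rV[R]_N -> R) i :
  definable_curve z -> definable_fun F -> definable_fun (fun e => z (F e) 0 i).
Proof. by move=> /(_ i); exact: definable_fun1_comp. Qed.

Lemma definable_surface_comp N m (z : R -> R -> 'rV[R]_m) (F G : 'rV[R]_N ->
    R) i :
  definable_surface z -> definable_fun F -> definable_fun G ->
      definable_fun (fun e => z (F e) (G e) 0 i).
Proof. by move=> /(_ i); exact: definable_fun2_comp. Qed.

End Definability.

(** The three tactics below follow the syntax of a predicate or function of a
    context vector e, whose parts are read off with lsubmx and rsubmx; a bound
    variable extends e on the right.  Hypotheses are tried first, for the sets,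
    functions and curves that occur as parameters. *)
Ltac definability_fun :=
  lazymatch goal with
  | |- definable_fun _ (fun _ => ?c) => apply: dfun_const
  | |- definable_fun _ (fun e => @?F e + @?G e) => apply: dfun_add
  | |- definable_fun _ (fun e => - @?F e) => apply: dfun_opp
  | |- definable_fun _ (fun e => @?F e * @?G e) => apply: dfun_mul
  | |- definable_fun _ (fun e => @?F e ^+ _) => apply: dfun_exp
  | |- definable_fun _ (fun e => `|@?F e|) => apply: dfun_norm
  | |- definable_fun _ (fun e => if `[< @?P e >] then _ else _) =>
      apply: dfun_if
  | |- definable_fun _ (fun e => bigop.body _ _ _) => apply: dfun_sum => ?
  | |- definable_fun _ (fun e => dotv (@?F e) (@?G e)) => apply: dfun_dotv
  | |- definable_fun _ (fun e => fun_of_matrix e _ _) => apply: dfun_coord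
  | |- definable_fun _ (fun e => fun_of_matrix (lsubmx (@?F e)) _ _) =>
      apply: dfun_lsub
  | |- definable_fun _ (fun e => fun_of_matrix (rsubmx (@?F e)) _ _) =>
      apply: dfun_rsub
  | |- definable_fun _ (fun e => fun_of_matrix (row_mx (@?F e) (@?G e)) _ _) =>
      apply: dfun_row
  | |- definable_fun _ (fun e => fun_of_matrix ((scalar_mx (@?F e))) _ _) =>
      apply: dfun_scalar_mx
  | |- definable_fun _ (fun e => fun_of_matrix ((@?F e + @?G e)) _ _) =>
      apply: dfun_addv
  | |- definable_fun _ (fun e => fun_of_matrix ((- @?F e)) _ _) =>
      apply: dfun_oppv
  end.

Ltac definability_step :=
  lazymatch goal with
  | |- definable_map _ _ => move=> ?
  | |- definable_curve _ _ => move=> ?; rewrite /definable_fun1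
  | |- definable_surface _ _ => move=> ?; rewrite /definable_fun2
  | |- definable1 _ _ => rewrite /definable1
  | |- definable2 _ _ => rewrite /definable2
  | |- definable_fun1 _ _ => rewrite /definable_fun1
  | |- definable_fun2 _ _ => rewrite /definable_fun2
  | |- definable _ (fun e => @?P e /\ @?Q e) => apply: definable_and
  | |- definable _ (fun e => @?P e \/ @?Q e) => apply: definable_or
  | |- definable _ (fun e => ~ (@?P e)) => apply: definable_not
  | |- definable _ (fun e => is_true (@?P e <= @?Q e)) => apply: definable_le
  | |- definable _ (fun e => is_true (@?P e < @?Q e)) => apply: definable_lt
  | |- definable _ (fun e => @?P e = @?Q e) => apply: definable_eq
  | |- definable _ (fun e => (@?P e) -> (@?Q e)) => apply: definable_imp
  | |- definable _ (fun e => forall i : ordinal _, @?P e i) =>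
      apply: definable_forall_ord => ?
  | |- definable _ (fun e => forall y : matrix _ _ _, @?P e y) =>
      apply: definable_forall
  | |- definable _ (fun e => exists y : matrix _ _ _, @?P e y) =>
      apply: definable_exists
  | |- definable _ (fun e => forall y, @?P e y) => apply: definable_forallR
  | |- definable _ (fun e => exists y, @?P e y) => apply: definable_existsR
  | |- definable_fun _ _ => definability_fun
  end.

Ltac definability_hyp :=
  match goal with
  | H : definable _ ?P |- definable _ (fun e => ?P (@?F e)) =>
      apply: (definable_subst H)
  | H : definable1 _ ?P |- definable _ (fun e => ?P (@?F e)) =>
      apply: (definable1_comp H)
  | H : definable2 _ ?P |- definable _ (fun e => ?P (@?F e) (@?G e)) =>
      apply: (definable2_comp H)
  | H : definable_fun1 _ ?g |- definable_fun _ (fun e => ?g (@?F e)) =>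
      apply: (definable_fun1_comp H)
  | H : definable_fun2 _ ?g |- definable_fun _ (fun e => ?g (@?F e) (@?G e)) =>
      apply: (definable_fun2_comp H)
  | H : definable_curve _ ?z |- definable_fun _ (fun e =>
      fun_of_matrix (?z (@?F e)) _ _) => apply: (definable_curve_comp _ H)
  | H : definable_surface _ ?z |- definable_fun _ (fun e =>
      fun_of_matrix (?z (@?F e) (@?G e)) _ _) =>
      apply: (definable_surface_comp _ H)
  | H : definable_map _ ?F |- definable_fun _ (fun e =>
      fun_of_matrix (?F (@?G e)) _ _) => apply: (dfun_vcomp _ H)
  | H : definable_fun _ ?F |- definable_fun _ (fun e => ?F (@?G e)) =>
      apply: (dfun_comp H)
  end.

Ltac definability := repeat (first [definability_hyp | definability_step]).

(** * Infima of definable families *)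
Section DefinableInf.
Variables (R : realType) (O : forall n : nat, set (set 'rV[R]_n)).
Context {ominO : ominimal O}.

(** The value is described by the order, with the convention that the infimum
    is 0 when the set is empty or unbounded below. *)
Lemma dfun_inf N (Q : 'rV[R]_N -> R -> Prop) :
  definable O (fun e : 'rV[R]_(N + 1) => Q (lsubmx e) (rsubmx e 0 0)) ->
  definable_fun O (fun e => inf [set y | Q e y]).
Proof.
move=> HQ.
have HQ' M (F : 'rV[R]_M -> 'rV[R]_N) (G : 'rV[R]_M -> R) :
    definable_map O F -> definable_fun O G -> definable O (fun e =>
        Q (F e) (G e)).
  move=> HF HG.
  apply: definable_ext (definable_subst HQ (dmap_row HF (dmap_scalar HG))) => e.
  by rewrite row_mxKl row_mxKr mxE eqxx.
pose bd (e : 'rV[R]_N) := (exists y : R, Q e y) /\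
   (exists l : R, forall y : R, Q e y -> l <= y).
rewrite /definable_fun.
apply: (@definable_ext _ _ _ (fun e : 'rV[R]_(N + 1) =>
  (bd (lsubmx e) /\
   ((forall y : R, Q (lsubmx e) y -> rsubmx e 0 0 <= y) /\
   (forall w : R, (forall y : R, Q (lsubmx e) y -> w <= y) ->
       w <= rsubmx e 0 0)))
  \/ (~ bd (lsubmx e) /\ 0 = rsubmx e 0 0))); last first.
  rewrite /bd; definability; apply: HQ'; definability.
move=> e; set S := [set y | _]; set v := rsubmx e 0 0.
have bdE : bd (lsubmx e) <-> has_inf S.
  by split=> [[[y Qy] [l Hl]]|[[y Qy] [l Hl]]]; split;
      [exists y|exists l|exists y|exists l].
split.
  case=> [[/bdE hS [lb glb]]|[nbd <-]]; last first.
    by rewrite inf_out // => /bdE.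
  apply/eqP; rewrite eq_le; apply/andP; split.
    by apply: glb => y Sy; exact: (ge_inf hS.2).
  by apply: lb_le_inf => //; exact: hS.1.
move=> <-; have [hb|nb] := pselect (bd (lsubmx e)); [left|right]; last first.
  by split=> //; rewrite inf_out // => /bdE.
have hS := (bdE.1 hb); split=> //; split.
  by move=> y Sy; exact: (ge_inf hS.2).
by move=> w Hw; apply: lb_le_inf => //; exact: hS.1.
Qed.

End DefinableInf.

(** * Definable subsets of the line *)
Section OneVariable.
Variables (R : realType) (O : forall n : nat, set (set 'rV[R]_n)).
Context {ominO : ominimal O}.

Lemma definable1_itv (A : R -> Prop) : definable1 O A ->
  exists s : seq (interval R), forall x, A x <-> exists2 I, I \in s & x \in I.
Proof.
move=> /(ominimal_line ominO)[s Es]; exists s => x.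
have /(congr1 (fun S => S (x%:M : 'rV[R]_1))) /= := Es.
by rewrite mxE eqxx mulr1n => ->.
Qed.

Lemma itv_between (I : interval R) x y u :
  x \in I -> y \in I -> x < u < y -> u \in I.
Proof.
move=> xI yI /andP[xu uy].
by apply: (@interval_is_interval _ I x y) => //; rewrite !ltW.
Qed.

Definition ev_right (a : R) (P : R -> Prop) :=
  exists d, 0 < d /\ forall x, a < x -> x < a + d -> P x.

Lemma ev_right_and a P Q : ev_right a P -> ev_right a Q -> ev_right a (fun x =>
    P x /\ Q x).
Proof.
move=> [d [d0 HP]] [e [e0 HQ]]; exists (Num.min d e).
split; first by rewrite lt_min d0.
move=> x ax xm; split; [apply: HP|apply: HQ] => //; apply: (lt_le_trans xm);
  by rewrite lerD2l ge_min lexx ?orbT.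
Qed.

Lemma ev_right_sub a (P Q : R -> Prop) :
  (forall x, a < x -> P x -> Q x) -> ev_right a P -> ev_right a Q.
Proof. by move=> PQ [d [d0 HP]]; exists d; split=> // x ax xd; apply: PQ => //;
    exact: HP. Qed.

Lemma ev_right_lt a b : a < b -> ev_right a (fun x => x < b).
Proof. by move=> ab; exists (b - a); split=> [|x _];
    rewrite ?subr_gt0 // subrKC. Qed.

Lemma ev_right_ex a P : ev_right a P -> exists2 x, a < x & P x.
Proof. by move=> [d [d0 HP]]; exists (a + d / 2); [lra|apply: HP; lra]. Qed.

Lemma ev_right_exlt a b P : a < b -> ev_right a P -> exists x, [/\ a < x,
    x < b & P x].
Proof.
by move=> /ev_right_lt/[swap] HP /(ev_right_and HP)/ev_right_ex[x ax [Px xb]];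
    exists x.
Qed.

(** This is where finiteness of the union of intervals enters: near the right of
    a, each interval is everything or nothing. *)
Lemma ev_right_dec a (A : R -> Prop) : definable1 O A ->
  ev_right a A \/ ev_right a (fun x => ~ A x).
Proof.
move=> /definable1_itv[s Hs].
have HI (I : interval R) : ev_right a (fun x => x \in I) \/
    ev_right a (fun x => ~ (x \in I)).
  have [|nH] := pselect (ev_right a (fun x => ~ (x \in I))); [by right|left].
  have Hd d : 0 < d -> exists x, [/\ a < x, x < a + d & x \in I].
    move=> d0; apply: contrapT => nE; apply: nH; exists d; split=>
        // x ax xd xI.
    by apply: nE; exists x.
  have [y [ay _ yI]] := Hd 1 ltr01; exists (y - a).
  split; first by rewrite subr_gt0.
  move=> x ax; rewrite subrKC => xy.
  have [|z [az zx zI]] := Hd (x - a); first by rewrite subr_gt0.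
  by apply: (itv_between zI yI); rewrite xy andbT; rewrite subrKC in zx.
suff [H|H] : ev_right a (fun x => exists2 I, I \in s & x \in I) \/
       ev_right a (fun x => ~ exists2 I, I \in s & x \in I).
- by left; apply: ev_right_sub H => x _ /Hs.
- by right; apply: ev_right_sub H => x _ nH /Hs.
elim: s {Hs} => [|I s IHs]; first by right; exists 1; split=> // x _ _ [].
have [H|H] := HI I; first by left; apply: ev_right_sub H => x _ xI; exists I;
    rewrite ?mem_head.
have [H'|H'] := IHs.
  by left; apply: ev_right_sub H' => x _ [J Js xJ]; exists J;
      rewrite // inE Js orbT.
right; apply: ev_right_sub (ev_right_and H H') => x _ [nI nE] [J].
by rewrite inE => /orP[/eqP->//|Js xJ]; apply: nE; exists J.
Qed.

Lemma ev_right_not a (A : R -> Prop) : definable1 O A ->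
  ~ ev_right a A -> ev_right a (fun x => ~ A x).
Proof. by move=> /(ev_right_dec a)[]. Qed.

Definition holds_on (a b : R) (A : R -> Prop) := forall x, a < x -> x < b ->
    A x.

(** A definable set without interior is a finite union of points, and an
    interval is not a countable union of finite sets. *)
Lemma itv_countable_cover (a b : R) (A : nat -> R -> Prop) :
  a < b -> (forall k, definable1 O (A k)) -> holds_on a b (fun x => exists k,
      A k x) ->
  exists k c d, [/\ a <= c, c < d, d <= b & holds_on c d (A k)].
Proof.
move=> ab HA cov; apply: contrapT => nE.
(* Two points of one of the intervals of A k would span a subinterval in A k. *)
have small k : countable [set x | a < x < b /\ A k x].
  have [s Hs] := definable1_itv (HA k).
  have HI I : I \in s -> countable [set x | a < x < b /\ x \in I].
    move=> Is.
    have sub x y : a < x < b -> a < y < b -> x \in I -> y \in I -> x < y ->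
        False.
      move=> /andP[ax xb] /andP[ay yb] xI yI xy; apply: nE.
      exists k, x, y; split; rewrite ?ltW // => u xu uy; apply/Hs; exists I =>
          //.
      by apply: (itv_between xI yI); rewrite xu.
    have [[x [xab xI]]|nx] := pselect (exists x, a < x < b /\ x \in I).
      rewrite (_ : [set _ | _] = [set x]); first exact: finite_set_countable.
      apply/seteqP; split=> [y /= [yab yI]|y /= ->] //.
      by have [/(sub _ _ yab xab yI xI)|/(sub _ _ xab yab xI yI)|] := ltgtP y x.
    rewrite (_ : [set _ | _] = set0); first exact: finite_set_countable.
    by apply/seteqP; split=> y //= ?; apply: nx; exists y.
  have : countable (\bigcup_(I in [set` s]) [set x | a < x < b /\ x \in I]).
    apply: bigcup_countable => //; exact: finite_set_countable.
  apply: sub_countable; apply: subset_card_le => x /= [xab /Hs[I Is xI]].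
  by exists I.
have : countable (\bigcup_(k in [set: nat]) [set x | a < x < b /\ A k x]).
  by apply: bigcup_countable => //; exact: countable_setT.
move=> /(sub_countable (A := `]a, b[%classic)) H.
have : countable `]a, b[%classic.
  apply: H; apply: subset_card_le => x; rewrite /= in_itv /= => xab.
  by have /andP[/cov/[apply] [[k Ak]]] := xab; exists k.
(* A countable interval would have length 0. *)
move=> /countable_lebesgue_measure0; rewrite lebesgue_measure_itv /= lte_fin ab.
by rewrite -EFinD => -[] /eqP; rewrite subr_eq0 gt_eqF.
Qed.

End OneVariable.

(** * Properties that hold on a dense set of an interval *)
Section Generic.
Variables (R : realType) (O : forall n : nat, set (set 'rV[R]_n)).
Context {ominO : ominimal O}.

Lemma holds_on_cover2 a b (A B : R -> Prop) : a < b -> definable1 O A ->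
    definable1 O B ->
  holds_on a b (fun x => A x \/ B x) ->
  exists c d, [/\ a <= c, c < d, d <= b & holds_on c d A \/ holds_on c d B].
Proof.
move=> ab HA HB H.
have [||k [c [d [ac cd db Hk]]]] := @itv_countable_cover R O _ a b
  (fun k => if k is 0%N then A else B) ab; first by case.
- by move=> x ax xb; have [?|?] := H x ax xb; [exists 0%N|exists 1%N].
- by exists c, d; split=> //; case: k Hk; [left|right].
Qed.

Lemma holds_on_dec a b (A : R -> Prop) : a < b -> definable1 O A ->
  exists c d, [/\ a <= c, c < d, d <= b & holds_on c d A \/
      holds_on c d (fun x => ~ A x)].
Proof.
move=> ab HA; apply: holds_on_cover2 => //; first by definability.
by move=> x _ _; exact: EM.
Qed.

(** For a definable property, density, holding on a subinterval of every
    subinterval, and failing on no subinterval are the same thing. *)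
Definition dense_in (a b : R) (A : R -> Prop) :=
  forall c d, a <= c -> c < d -> d <= b -> exists x, [/\ c < x, x < d & A x].

Lemma dense_in_holds_on a b c d (A : R -> Prop) : definable1 O A ->
    dense_in a b A ->
  a <= c -> c < d -> d <= b ->
  exists c' d', [/\ c <= c', c' < d', d' <= d & holds_on c' d' A].
Proof.
move=> HA gA ac cd db; have [c' [d' [cc c'd' dd [H|H]]]] := holds_on_dec cd HA.
  by exists c', d'.
have [||x [cx xd /(H _ cx xd)]//] := gA c' d' _ c'd'; first exact: le_trans cc.
exact: le_trans db.
Qed.

Lemma holds_on_dense_in a b (A : R -> Prop) :
  (forall c d, a <= c -> c < d -> d <= b ->
    exists c' d', [/\ c <= c', c' < d', d' <= d & holds_on c' d' A]) ->
        dense_in a b A.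
Proof.
move=> H c d ac cd db; have [c' [d' [cc c'd' dd HA]]] := H c d ac cd db.
exists ((c' + d') / 2); split; [lra|lra|apply: HA; lra].
Qed.

Lemma dense_in_contra a b (A : R -> Prop) : definable1 O A ->
  (forall c d, a <= c -> c < d -> d <= b -> holds_on c d (fun x => ~ A x) ->
      False) ->
  dense_in a b A.
Proof.
move=> HA H c d ac cd db; have [c' [d' [cc c'd' dd [H'|H']]]] :=
    holds_on_dec cd HA.
  exists ((c' + d') / 2); split; [lra|lra|apply: H'; lra].
by case: (H c' d') => //; [exact: le_trans cc|exact: le_trans db].
Qed.

Lemma dense_in_and a b (A B : R -> Prop) : definable1 O A -> dense_in a b A ->
    dense_in a b B ->
  dense_in a b (fun x => A x /\ B x).
Proof.
move=> HA gA gB c d ac cd db.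
have [c' [d' [cc c'd' dd HA']]] := dense_in_holds_on HA gA ac cd db.
have [||x [cx xd Bx]] := gB c' d' _ c'd';
    [exact: le_trans cc|exact: le_trans db|].
exists x; split; [exact: le_lt_trans cx|exact: lt_le_trans dd|split=> //].
exact: HA'.
Qed.

Lemma dense_in_sub a b a' b' (A B : R -> Prop) : a <= a' -> b' <= b ->
  (forall x, a' < x -> x < b' -> A x -> B x) -> dense_in a b A ->
      dense_in a' b' B.
Proof.
move=> aa bb AB gA c d ac cd db.
have [||x [cx xd Ax]] := gA c d _ cd; [exact: le_trans ac|exact: le_trans bb|].
exists x; split=> //; apply: AB => //; first exact: le_lt_trans cx.
exact: lt_le_trans db.
Qed.

Lemma dense_in_ord a b k (A : R -> 'I_k -> Prop) : (forall i,
    definable1 O (A ^~ i)) ->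
  (forall i, dense_in a b (A ^~ i)) -> dense_in a b (fun x => forall i, A x i).
Proof.
elim: k A => [|k IHk] A HA gA.
  move=> c d _ cd _; exists ((c + d) / 2); split; [lra|lra|by case].
have H0 := gA ord0.
have H1 := IHk _ (fun i => HA (lift ord0 i)) (fun i => gA (lift ord0 i)).
apply: dense_in_sub (dense_in_and (HA ord0) H0 H1) => // x _ _ [Ax0 AxS] i.
by case: (unliftP ord0 i) => [j|] ->.
Qed.

(** The exceptional set cannot accumulate at a, as it would then contain an
    interval. *)
Lemma dense_in_ev_right a b (A : R -> Prop) : a < b -> definable1 O A ->
    dense_in a b A -> ev_right a A.
Proof.
move=> ab HA gA; have [//|H] := ev_right_dec a HA.
have [d [d0 Hd]] := ev_right_and H (ev_right_lt ab).
have [|||x [ax xd Ax]] := gA a (Num.min b (a + d)) => //.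
- by rewrite lt_min ab ltrDl.
- by rewrite ge_min lexx.
by case: (Hd x ax) => //; rewrite (lt_le_trans xd)// ge_min lexx orbT.
Qed.

(** Cover the interval by the sets of t for which all s < 1 / k.+1 are good. *)
Lemma ev_right_uniform (Q : R -> R -> Prop) a b : definable2 O Q -> a < b ->
  holds_on a b (fun t => ev_right 0 (Q t)) ->
  exists c d s0, [/\ a <= c, c < d, d <= b, 0 < s0 &
    forall t s, c < t -> t < d -> 0 < s -> s < s0 -> Q t s].
Proof.
move=> HQ ab H.
have [||k [c [d [ac cd db Hk]]]] := @itv_countable_cover R O _ a b
  (fun k t => forall s, 0 < s -> s < k.+1%:R^-1 -> Q t s) ab.
- by move=> k; definability.
- move=> t at_ tb; have [e [e0 He]] := H t at_ tb.
  have := near_infty_natSinv_lt (PosNum e0) => -[k _ /(_ k)/= ke].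
  exists k => s s0 sk; apply: He => //; rewrite add0r; apply: lt_trans sk _.
  exact: ke.
exists c, d, (k.+1%:R^-1); split=> // t s ct td; exact: Hk.
Qed.

(** If the property failed for small s at every t of an interval, it would fail
    on a box, against the hypothesis for one fixed s. *)
Lemma dense_in_fubini (P : R -> R -> Prop) a b s1 : 0 < s1 -> definable2 O P ->
  (forall s, 0 < s -> s < s1 -> dense_in a b (P ^~ s)) ->
  dense_in a b (fun t => ev_right 0 (P t)).
Proof.
move=> s10 HP gP; apply: dense_in_contra; first by rewrite /ev_right;
    definability.
move=> c d ac cd db H.
have H' : holds_on c d (fun t => ev_right 0 (fun s => ~ P t s)).
  by move=> t ct td; apply: ev_right_not; [definability|exact: H].
have [|c' [d' [s0 [cc c'd' dd s00 HP']]]] := ev_right_uniform _ cd H';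
    first by definability.
pose s := Num.min s0 s1 / 2.
have m0 : 0 < Num.min s0 s1 by rewrite lt_min s00.
have ms0 : Num.min s0 s1 <= s0 by rewrite ge_min lexx.
have ms1 : Num.min s0 s1 <= s1 by rewrite ge_min lexx orbT.
have s_gt0 : 0 < s by rewrite /s; lra.
have s_lt1 : s < s1 by rewrite /s; lra.
have [x [cx xd]] := gP s s_gt0 s_lt1 c' d' (le_trans ac cc) c'd' (le_trans dd
    db).
by apply: HP' => //; rewrite /s; lra.
Qed.

Definition rcont (g : R -> R) t :=
  forall e, 0 < e -> ev_right t (fun x => `|g x - g t| < e).
Definition lcont (g : R -> R) t :=
  forall e, 0 < e -> ev_right (- t) (fun x => `|g (- x) - g t| < e).

(** At a point of right discontinuity, g jumps over some rational q. If this
    happens with the same q at all points of an interval, then g would be on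
    both sides of q at the same points. *)
Lemma dense_in_rcont (g : R -> R) a b : definable_fun1 O g ->
    dense_in a b (rcont g).
Proof.
move=> Hg; apply: dense_in_contra; first by rewrite /rcont /ev_right;
    definability.
move=> c d _ cd _ H.
(* B q t: g jumps over q immediately to the right of t. *)
pose B q t := (g t < q /\ ev_right t (fun x => q < g x)) \/
              (q < g t /\ ev_right t (fun x => g x < q)).
have HB q : definable1 O (B q) by rewrite /B /ev_right; definability.
have [||k [c' [d' [cc c'd' dd Hk]]]] := @itv_countable_cover R O _ c d
  (fun k t => if unpickle k is Some q then B (ratr q : R) t else False) cd.
- move=> k; case: unpickle => [q|]; first exact: HB.
  by definability; apply: definable_const.
- move=> t ct td; apply: contrapT => nB; apply: (H t ct td) => e e0.
  apply: contrapT => nev; apply: nB.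
  have : ev_right t (fun x => g t + e <= g x) \/ ev_right t (fun x =>
      g x <= g t - e).
    have [|?|H0] := @ev_right_dec R O _ t (fun x => g t + e <= g x);
        [by definability|by left|].
    right; have E : ev_right t (fun x => ~ (`|g x - g t| < e)).
      by apply: ev_right_not => //; definability.
    apply: ev_right_sub (ev_right_and E H0) => x _ [/negP]; rewrite -leNgt.
    by rewrite ler_normr => /orP[]; move=> ? /negP; rewrite -ltNge; lra.
  move=> [E|E].
    have [|q] := @rat_in_itvoo R (g t) (g t + e); first lra.
    rewrite in_itv /= => /andP[q1 q2]; exists (pickle q); rewrite pickleK.
    by left; split=> //; apply: ev_right_sub E => x _; exact: lt_le_trans.
  have [|q] := @rat_in_itvoo R (g t - e) (g t); first lra.
  rewrite in_itv /= => /andP[q1 q2]; exists (pickle q); rewrite pickleK.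
  by right; split=> //; apply: ev_right_sub E => x _; move/le_lt_trans; exact.
case: unpickle Hk => [q|] Hk; last by apply: (Hk ((c' + d') / 2)); lra.
have ct : c' < (c' + d') / 2 by lra.
have td : (c' + d') / 2 < d' by lra.
(* Two successive points of the interval, the second in the range of the jump at
   the first. *)
have step (P Q : R -> Prop) : ev_right ((c' + d') / 2) P ->
    (forall x, P x -> B (ratr q) x -> ev_right x Q) -> exists y, P y /\ Q y.
  move=> [s [s0 Hs]] HQ.
  have ts : (c' + d') / 2 < (c' + d') / 2 + s by lra.
  have E : ev_right ((c' + d') / 2) P by exists s.
  have [x [tx xd [Px xs]]] := ev_right_exlt td (ev_right_and E (ev_right_lt
      ts)).
  have [|y [xy yd Qy]] := ev_right_exlt xs (HQ x Px _).
    by apply: Hk => //; exact: lt_trans tx.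
  by exists y; split=> //; apply: Hs => //; exact: lt_trans tx xy.
have [[_ E]|[_ E]] := Hk _ ct td.
  have [|y [/lt_trans/[apply]]] := step _ (fun y => g y < ratr q) E;
      last by rewrite ltxx.
  by move=> x qx [[/lt_trans/(_ qx)]|[]//]; rewrite ltxx.
have [|y [/lt_trans/[apply]]] := step _ (fun y => ratr q < g y) E;
    last by rewrite ltxx.
by move=> x qx [[]//|[/(lt_trans qx)]]; rewrite ltxx.
Qed.

Lemma dense_in_cont (g : R -> R) a b : definable_fun1 O g ->
    dense_in a b (fun t => rcont g t /\ lcont g t).
Proof.
move=> Hg; apply: dense_in_and; first by rewrite /rcont /ev_right; definability.
  exact: dense_in_rcont.
move=> c d _ cd _.
have HgN : definable_fun1 O (fun x => g (- x)) by definability.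
have [|x [dx xc Hx]] := dense_in_rcont HgN (lexx (- d)) _ (lexx (- c)).
  by rewrite ltrN2.
exists (- x); split; [lra|lra|].
by move=> e e0; rewrite opprK; exact: Hx.
Qed.

(** A supremum argument; the second hypothesis, weaker than continuity, only
    keeps k from dropping on the way to the supremum. *)
Lemma local_growth (k : R -> R) a b :
  (forall t, a < t -> t < b -> ev_right t (fun x => k t <= k x)) ->
  (forall t, a < t -> t < b ->
     forall e, 0 < e -> ev_right (- t) (fun x => k (- x) <= k t + e)) ->
  forall x y, a < x -> x < y -> y < b -> k x <= k y.
Proof.
move=> HR HL x y ax xy yb.
pose S := [set u | x <= u <= y /\ k x <= k u].
have Sx : S x by rewrite /S /= lexx ltW.
have hS : has_sup S by split; [exists x|exists y => u [/andP[]]].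
have xc : x <= sup S by exact: (ub_le_sup hS.2).
have cy : sup S <= y by apply: ge_sup; [exists x|move=> u [/andP[]]].
set c := sup S in xc cy.
have ac : a < c by exact: lt_le_trans xc.
have cb : c < b by exact: le_lt_trans yb.
have kc : k x <= k c.
  apply/ler_addgt0Pr => e e0; have [d [d0 Hd]] := HL c ac cb e e0.
  have [u [/andP[xu uy] ku] cu] := sup_adherent d0 hS.
  have uc : u <= c by apply: (ub_le_sup hS.2); rewrite /S /= xu uy.
  move: uc; rewrite le_eqVlt => /orP[/eqP uc|uc].
    by rewrite -uc (le_trans ku)// lerDl ltW.
  apply: le_trans ku _; rewrite -[u]opprK; apply: Hd; first by rewrite ltrN2.
  rewrite -/c in cu; lra.
move: cy; rewrite le_eqVlt => /orP[/eqP <-//|cy].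
have [u [cu uy ku]] := ev_right_exlt cy (HR c ac cb).
have : u <= c.
  apply: (ub_le_sup hS.2); rewrite /S /= (le_trans xc (ltW cu)) (ltW uy).
  by split=> //; exact: le_trans ku.
by rewrite leNgt cu.
Qed.
End Generic.

(** * Strict differentiability of definable functions *)
Section Differentiability.
Variables (R : realType) (O : forall n : nat, set (set 'rV[R]_n)).
Context {ominO : ominimal O}.

(** The increments compared are those between any two points near t, not only
    from t. This makes the existence of c at all points of an interval
    equivalent to continuous differentiability there. *)
Definition strict_derive (g : R -> R) (t c : R) := forall e, 0 < e ->
  exists d, 0 < d /\ forall x y, `|x - t| < d -> `|y - t| < d ->
    `|g y - g x - c * (y - x)| <= e * `|y - x|.

Lemma lcont_le (g : R -> R) c t : lcont g t ->
  forall e, 0 < e -> ev_right (- t) (fun x =>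
      g (- x) - c * (- x) <= g t - c * t + e).
Proof.
move=> Hg e e0; have e2 : 0 < e / 2 by lra.
(* In a window of this width the linear term moves by at most e / 2. *)
have H2 : ev_right (- t) (fun x => x < - t + e / 2 / (`|c| + 1)).
  by apply: ev_right_lt; rewrite ltrDl divr_gt0// ltr_wpDl.
apply: ev_right_sub (ev_right_and (Hg _ e2) H2) => x tx [].
rewrite ltr_norml => /andP[_ gx] xt.
have : `|c| * (x + t) <= e / 2.
  have : (`|c| + 1) * (x + t) <= e / 2.
    by rewrite mulrC -ler_pdivlMr ?ltr_wpDl//; lra.
  by apply: le_trans; rewrite ler_wpM2r//; lra.
have : c * (x + t) <= `|c| * (x + t).
  by rewrite ler_wpM2r ?ler_norm//; lra.
lra.
Qed.

Lemma slope_le (g : R -> R) c a b :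
  (forall t, a < t -> t < b -> lcont g t) ->
  (forall t, a < t -> t < b -> ev_right t (fun x =>
      c * (x - t) <= g x - g t)) ->
  forall x y, a < x -> x < y -> y < b -> c * (y - x) <= g y - g x.
Proof.
move=> Hc HR x y ax xy yb.
suff : g x - c * x <= g y - c * y by lra.
apply: (@local_growth R (fun t => g t - c * t) a b) => //.
  by move=> t at_ tb; apply: ev_right_sub (HR t at_ tb) => u _; lra.
by move=> t at_ tb e e0; apply: lcont_le => //; exact: Hc.
Qed.

Lemma lcontN (g : R -> R) t : lcont g t -> lcont (fun x => - g x) t.
Proof.
move=> H e e0; apply: ev_right_sub (H e e0) => x _.
by rewrite -opprD normrN.
Qed.

(** Otherwise the right slope is infinite, with a constant sign, on an interval
    where g is continuous, and g grows by arbitrary amounts there. *)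
Lemma dense_in_slope_bounded (g : R -> R) a b : definable_fun1 O g ->
  dense_in a b (fun t => exists K, ev_right t (fun x =>
      `|g x - g t| <= K * (x - t))).
Proof.
move=> Hg; apply: dense_in_contra; first by rewrite /ev_right; definability.
move=> c d _ cd _ H.
have [|c1 [d1 [cc c1d1 dd Hcont]]] := dense_in_holds_on _ (dense_in_cont (a :=
    c) (b := d) Hg) (lexx c) cd (lexx d).
  by rewrite /rcont /lcont /ev_right; definability.
pose Pinf t := forall K, ev_right t (fun x => K * (x - t) <= g x - g t).
pose Minf t := forall K, ev_right t (fun x => K * (x - t) <= - g x - - g t).
have HP : definable1 O Pinf by rewrite /Pinf /ev_right; definability.
have HM : definable1 O Minf by rewrite /Minf /ev_right; definability.
have ev_dec t (P : R -> Prop) : definable1 O P -> ev_right t P \/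
    ev_right t (fun x => ~ P x).
  exact: ev_right_dec.
have cov : holds_on c1 d1 (fun t => Pinf t \/ Minf t).
  move=> t ct td; apply: contrapT => /not_orP[nP nM].
  move/existsNP: nP => [K1]; move/existsNP: nM => [K2] n2 n1.
  apply: (H t); [exact: le_lt_trans ct|exact: lt_le_trans dd|].
  (* K1 and K2 refute the two infinite slopes, so they bound the slope on both
     sides. *)
  exists (`|K1| + `|K2|).
  have [|//|E2] := ev_dec t (fun x => K2 * (x - t) <= - g x - - g t);
      first by definability.
  have [|//|E1] := ev_dec t (fun x => K1 * (x - t) <= g x - g t);
      first by definability.
  apply: ev_right_sub (ev_right_and E1 E2) => x tx [/negP + /negP];
      rewrite -!ltNge => h1 h2.
  have p : 0 <= x - t by lra.
  have a1 := ler_wpM2r p (ler_norm K1); have a2 := ler_wpM2r p (ler_norm K2).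
  have b1 := mulr_ge0 (normr_ge0 K1) p; have b2 := mulr_ge0 (normr_ge0 K2) p.
  by rewrite ler_norml; apply/andP; split; lra.
have nslope (h : R -> R) c2 d2 : c2 < d2 -> (forall t, c2 < t -> t < d2 ->
    lcont h t) ->
    holds_on c2 d2 (fun t => forall K, ev_right t (fun x =>
        K * (x - t) <= h x - h t)) -> False.
  move=> cd2 Hl HK.
  set x := c2 + (d2 - c2) / 3; set y := c2 + (d2 - c2) * 2 / 3.
  have c2x : c2 < x by rewrite /x; lra.
  have yd2 : y < d2 by rewrite /y; lra.
  have xy : x < y by rewrite /x /y; lra.
  (* An infinite slope is applied with a constant larger than the actual
     growth. *)
  have := @slope_le h ((h y - h x + 1) / (y - x)) c2 d2 Hl _ x y c2x xy yd2.
  rewrite mulfVK ?subr_eq0 ?gt_eqF//.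
  by move=> /(_ (fun t ct td => HK t ct td _)); lra.
have [c2 [d2 [cc2 cd2 dd2 [H2|H2]]]] := holds_on_cover2 c1d1 HP HM cov.
  apply: (nslope g c2 d2) => // t ct td.
  by have [] := Hcont t (le_lt_trans cc2 ct) (lt_le_trans td dd2).
apply: (nslope (fun x => - g x) c2 d2) => // t ct td; apply: lcontN.
by have [] := Hcont t (le_lt_trans cc2 ct) (lt_le_trans td dd2).
Qed.

(** The right derivative D of g is finite at most points and is itself
    definable, hence continuous at most points; where D and g are continuous,
    comparing g with affine functions of slope D t + e and D t - e turns the
    one-sided estimate at all nearby points into a strict derivative. *)
Lemma dense_in_strict_derive (g : R -> R) a b : definable_fun1 O g ->
    dense_in a b (fun t => exists c, strict_derive g t c).
Proof.
move=> Hg; apply: holds_on_dense_in => c d ac cd db.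
have [|c1 [d1 [cc c1d1 dd Hcont]]] := dense_in_holds_on _ (dense_in_cont (a :=
    c) (b := d) Hg) (lexx c) cd (lexx d).
  by rewrite /rcont /lcont /ev_right; definability.
have [|c2 [d2 [cc2 cd2 dd2 Hbd]]] :=
    dense_in_holds_on _ (dense_in_slope_bounded (a := c1) (b :=
    d1) Hg) (lexx c1) c1d1 (lexx d1).
  by rewrite /ev_right; definability.
pose D t := inf [set m | ev_right t (fun x => g x - g t <= m * (x - t))].
have HD : definable_fun1 O D by apply: dfun_inf; rewrite /ev_right;
    definability.
have [|c3 [d3 [cc3 cd3 dd3 HDc]]] := dense_in_holds_on _ (dense_in_cont (a :=
    c2) (b := d2) HD) (lexx c2) cd2 (lexx d2).
  by rewrite /rcont /lcont /ev_right; definability.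
have Hl t : c3 < t -> t < d3 -> lcont g t.
  move=> ct td; have [] // := Hcont t.
    by apply: le_lt_trans ct; apply: le_trans cc3.
  by apply: lt_le_trans td _; apply: le_trans dd2.
have Dprop t : c3 < t -> t < d3 ->
   (forall m, D t < m -> ev_right t (fun x => g x - g t <= m * (x - t))) /\
   (forall m, m < D t -> ev_right t (fun x => m * (x - t) <= g x - g t)).
  move=> ct td.
  have [K HK] := Hbd t (le_lt_trans cc3 ct) (lt_le_trans td dd3).
  set S := [set m | ev_right t (fun x => g x - g t <= m * (x - t))].
  have S0 : S !=set0.
    by exists K; apply: ev_right_sub HK => x _; exact: le_trans (ler_norm _).
  have Sl : has_lbound S.
    exists (- K) => m mS; have [x tx [h1 h2]] :=
        ev_right_ex (ev_right_and mS HK).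
    have p : 0 < x - t by lra.
    rewrite -(ler_pM2r p); apply: le_trans h1; rewrite mulNr lerNl.
    by apply: le_trans h2; rewrite -normrN ler_norm.
  split=> m hm.
    have [m' Sm' m'm] := inf_lt S0 hm.
    apply: ev_right_sub Sm' => x tx /le_trans; apply;
        rewrite ler_pM2r ?subr_gt0//.
    exact: ltW.
  have : ev_right t (fun x => ~ (g x - g t <= m * (x - t))).
    apply: ev_right_not; first by definability.
    by move=> /(ge_inf Sl); rewrite -/(D t) leNgt hm.
  by apply: ev_right_sub => x _ /negP; rewrite -ltNge => /ltW.
exists c3, d3; split=> //.
- by apply: le_trans cc3; apply: le_trans cc2.
- by apply: le_trans dd; apply: le_trans dd2.
move=> t0 ct0 t0d; exists (D t0) => e e0.
have [Dr Dl] := HDc t0 ct0 t0d.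
have e2 : 0 < e / 2 by lra.
have [d1' [d10 Hd1]] := ev_right_and (Dr _ e2) (ev_right_lt t0d).
have ct0' : - t0 < - c3 by rewrite ltrN2.
have [d2' [d20 Hd2]] := ev_right_and (Dl _ e2) (ev_right_lt ct0').
set del := Num.min d1' d2'.
have del1 : del <= d1' by rewrite ge_min lexx.
have del2 : del <= d2' by rewrite ge_min lexx orbT.
have del0 : 0 < del by rewrite lt_min d10.
have near t : t0 - del < t -> t < t0 + del ->
    [/\ c3 < t, t < d3, D t0 - e < D t & D t < D t0 + e].
  move=> t1 t2; have [tt|tt|<-] := ltgtP t0 t.
  - have [|] := Hd1 t tt; first by lra.
    by rewrite ltr_norml => /andP[? ?] ?; split; lra.
  - have [||] := Hd2 (- t); [lra|lra|].
    by rewrite opprK ltr_norml => /andP[? ?] ?; split; lra.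
  - by split; lra.
have up x y : t0 - del < x -> x < y -> y < t0 + del ->
    g y - g x <= (D t0 + e) * (y - x).
  move=> hx xy hy.
  suff : (- (D t0 + e)) * (y - x) <= - g y - - g x by lra.
  apply: (@slope_le (fun x => - g x) _ (t0 - del) (t0 + del)) => // t h1 h2.
    by have [? ? ? ?] := near t h1 h2; apply: lcontN; exact: Hl.
  have [h3 h4 h5 h6] := near t h1 h2; have [H _] := Dprop t h3 h4.
  by apply: ev_right_sub (H _ h6) => u _; lra.
have lo x y : t0 - del < x -> x < y -> y < t0 + del ->
    (D t0 - e) * (y - x) <= g y - g x.
  move=> hx xy hy.
  apply: (@slope_le g _ (t0 - del) (t0 + del)) => // t h1 h2.
    by have [? ? ? ?] := near t h1 h2; exact: Hl.
  have [h3 h4 h5 h6] := near t h1 h2; have [_ H] := Dprop t h3 h4.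
  exact: H.
exists del; split=> // x y; rewrite !ltr_norml => /andP[x1 x2] /andP[y1 y2].
have [xy|yx|->] := ltgtP x y; last by rewrite !subrr mulr0 subr0 normr0 mulr0.
  have h1 : t0 - del < x by lra.
  have h2 : y < t0 + del by lra.
  have p := up x y h1 xy h2; have q := lo x y h1 xy h2.
  by rewrite (@gtr0_norm _ (y - x)) ?ler_norml; lra.
have h1 : t0 - del < y by lra.
have h2 : x < t0 + del by lra.
have p := up y x h1 yx h2; have q := lo y x h1 yx h2.
by rewrite (@ltr0_norm _ (y - x)) ?ler_norml; lra.
Qed.
End Differentiability.

(** * Definable choice *)
Section Choice.
Variables (R : realType) (O : forall n : nat, set (set 'rV[R]_n)).
Context {ominO : ominimal O}.

Lemma definable_rel_comp N k M (S : 'rV[R]_N -> 'rV[R]_k -> Prop)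
    (F : 'rV[R]_M -> 'rV[R]_N) (G : 'rV[R]_M -> 'rV[R]_k) :
  definable O (fun e : 'rV[R]_(N + k) => S (lsubmx e) (rsubmx e)) ->
  definable_map O F -> definable_map O G -> definable O (fun e =>
      S (F e) (G e)).
Proof.
move=> HS HF HG; apply: definable_ext (definable_subst HS (dmap_row HF HG)) =>
    e.
by rewrite row_mxKl row_mxKr.
Qed.

Lemma definable_relR_comp N M (Q : 'rV[R]_N -> R -> Prop)
    (F : 'rV[R]_M -> 'rV[R]_N) (G : 'rV[R]_M -> R) :
  definable O (fun e : 'rV[R]_(N + 1) => Q (lsubmx e) (rsubmx e 0 0)) ->
  definable_map O F -> definable_fun O G -> definable O (fun e =>
      Q (F e) (G e)).
Proof.
move=> HQ HF HG.
have := @definable_rel_comp _ _ _ (fun x y =>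
    Q x (y 0 0)) F _ HQ HF (dmap_scalar HG).
by apply: definable_ext => e; rewrite mxE eqxx.
Qed.

(** The least element of T when there is one, and otherwise the middle of the
    longest interval of length at most 1 that follows inf T inside T. *)
Definition definable_pick_ge0 (T : set R) : R :=
  let r := inf T in
  if `[< T r >] then r
  else (r + inf [set u | r < u /\ (~ T u \/ r + 1 <= u)]) * 2^-1.

(** Negative elements are folded onto the positive half line and recovered by
    a test. *)
Definition definable_pick (S : set R) : R :=
  let r := definable_pick_ge0 [set u | 0 <= u /\ (S u \/ S (- u))] in
  if `[< S r >] then r else - r.

Lemma definable_pick_ge0P (T : set R) : definable1 O T -> T !=set0 ->
    (forall u, T u -> 0 <= u) ->
  T (definable_pick_ge0 T).
Proof.
move=> HT T0 Tge; rewrite /definable_pick_ge0; case: asboolP => // nTr.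
have hT : has_inf T by split=> //; exists 0.
set r := inf T in nTr *; set E := [set u | _].
(* As r = inf T is not attained, T fills an interval to the right of r. *)
have [d [d0 Hd]] : ev_right r T.
  have [//|[d [d0 Hd]]] := ev_right_dec r HT.
  have [u Tu ud] := inf_adherent d0 hT.
  have ru : r <= u by exact: (ge_inf hT.2).
  move: ru; rewrite le_eqVlt => /orP[/eqP ru|ru]; first by rewrite ru in nTr.
  by case: (Hd u ru ud).
have E1 : E (r + 1) by split; [lra|right].
have El : lbound E (Num.min (r + d) (r + 1)).
  move=> u [ru [nTu|ru1]]; rewrite ge_min ?ru1 ?orbT//.
  by apply/orP; left; rewrite leNgt; apply/negP => ud; apply: nTu; exact: Hd.
have rE : r < inf E.
  apply: (@lt_le_trans _ _ (Num.min (r + d) (r + 1))); first by rewrite lt_min;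
      lra.
  by apply: lb_le_inf => //; exists (r + 1).
apply: contrapT => nT.
have : inf E <= (r + inf E) * 2^-1.
  by apply: ge_inf; [exists (Num.min (r + d) (r + 1))|split; [lra|left]].
lra.
Qed.

Lemma definable_pickP (S : set R) : definable1 O S -> S !=set0 ->
    S (definable_pick S).
Proof.
move=> HS [x Sx]; rewrite /definable_pick; set T := [set u | _].
have [||u []//|_ [Sr|Sr]] := @definable_pick_ge0P T.
- by rewrite /T /definable1 /mkset; definability.
- exists `|x|; split=> //; have [x0|x0] := leP 0 x; [left|right].
    by rewrite ger0_norm.
  by rewrite ltr0_norm ?opprK.
- by case: asboolP.
by case: asboolP.
Qed.

Lemma dfun_definable_pick_ge0 N (Q : 'rV[R]_N -> R -> Prop) :
  definable O (fun e : 'rV[R]_(N + 1) => Q (lsubmx e) (rsubmx e 0 0)) ->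
  definable_fun O (fun e => definable_pick_ge0 [set u | Q e u]).
Proof.
move=> HQ; have Hr : definable_fun O (fun e =>
    inf [set u | Q e u]) by exact: dfun_inf.
rewrite /definable_pick_ge0 /mkset.
have Hs (r : 'rV[R]_N -> R) : definable_fun O r ->
    definable_fun O (fun e => inf [set u | r e < u /\ (~ Q e u \/
        r e + 1 <= u)]).
  by move=> Hr'; apply: dfun_inf; definability;
      apply: (definable_relR_comp HQ); definability.
have {}Hs := Hs _ Hr.
by definability => //; apply: (definable_relR_comp HQ) => //; definability.
Qed.

Lemma dfun_definable_pick N (Q : 'rV[R]_N -> R -> Prop) :
  definable O (fun e : 'rV[R]_(N + 1) => Q (lsubmx e) (rsubmx e 0 0)) ->
  definable_fun O (fun e => definable_pick (Q e)).
Proof.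
move=> HQ; rewrite /definable_pick.
have Hr : definable_fun O (fun e => definable_pick_ge0 [set u | 0 <= u /\
    (Q e u \/ Q e (- u))]).
  by apply: dfun_definable_pick_ge0; definability;
      apply: (definable_relR_comp HQ); definability.
by definability => //; apply: (definable_relR_comp HQ) => //; definability.
Qed.

(** Induction on the dimension of the fibre: the first coordinate is picked in
    the projection of the fibre, then the others in the slice above it. *)
Lemma definable_choice k N (S : 'rV[R]_N -> 'rV[R]_k -> Prop) :
  definable O (fun e : 'rV[R]_(N + k) => S (lsubmx e) (rsubmx e)) ->
  exists2 F, definable_map O F & forall e, (exists y, S e y) -> S e (F e).
Proof.
elim: k S => [|k IHk] S HS.
  exists (fun _ => 0); first by definability.
  by move=> e [y]; rewrite (thinmx0 y).
pose S1 e (c : R) := exists y : 'rV[R]_k, S e (row_mx c%:M y : 'rV[R]_(1 + k)).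
have HS1 : definable O (fun e : 'rV[R]_(N + 1) => S1 (lsubmx e) (rsubmx e 0 0)).
  by rewrite /S1; apply: definable_exists; apply: (definable_rel_comp HS);
      definability.
pose c e := definable_pick (S1 e); have Hc : definable_fun O c :=
    dfun_definable_pick HS1.
have [|F HF FP] := IHk (fun e y => S e (row_mx (c e)%:M y : 'rV[R]_(1 + k))).
  by apply: (definable_rel_comp HS); definability.
exists (fun e => row_mx (c e)%:M (F e) : 'rV[R]_(1 + k)).
  by move=> i; apply: dfun_row => //; definability.
move=> e [y Sy]; apply: FP; apply: (@definable_pickP (S1 e)).
  rewrite /definable1.
  apply: (@definable_relR_comp _ _ _ (fun _ => e) (fun u : 'rV_1 =>
      u 0 0) HS1); definability.
exists ((lsubmx (y : 'rV[R]_(1 + k))) 0 0); exists (rsubmx (y :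
    'rV[R]_(1 + k))).
by rewrite -row_const hsubmxK.
Qed.

Lemma choice_curve m (S : R -> 'rV[R]_m -> Prop) :
  definable O (fun e : 'rV[R]_(1 + m) => S (lsubmx e 0 0) (rsubmx e)) ->
  exists2 z, definable_curve O z & forall t, (exists y, S t y) -> S t (z t).
Proof.
move=> HS; have [|F HF FP] := @definable_choice m 1 (fun e y => S (e 0 0) y).
  exact: HS.
exists (fun t => F t%:M); first by definability.
by move=> t /= Ht; have := FP t%:M; rewrite mxE eqxx; apply.
Qed.

Lemma choice_surface m (S : R -> R -> 'rV[R]_m -> Prop) :
  definable O (fun e : 'rV[R]_(2 + m) =>
      S (lsubmx e 0 0) (lsubmx e 0 1) (rsubmx e)) ->
  exists2 z, definable_surface O z & forall t s, (exists y, S t s y) ->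
      S t s (z t s).
Proof.
move=> HS; have [|F HF FP] := @definable_choice m 2 (fun e y =>
    S (e 0 0) (e 0 1) y).
  exact: HS.
pose v (t s : R) : 'rV[R]_2 := row_mx t%:M s%:M : 'rV[R]_(1 + 1).
exists (fun t s => F (v t s)).
  by rewrite /v => i; rewrite /definable_fun2; apply: (dfun_vcomp _ HF) => j;
      apply: dfun_row; definability.
have E0 t s : v t s 0 0 = t.
  have -> : v t s 0 0 = v t s 0 (lshift 1 (0 : 'I_1)) by congr (v t s _ _);
      exact/val_inj.
  by transitivity ((t%:M : 'rV[R]_1) 0 0); [exact: row_mxEl|rewrite mxE eqxx].
have E1 t s : v t s 0 1 = s.
  have -> : v t s 0 1 = v t s 0 (rshift 1 (0 : 'I_1)) by congr (v t s _ _);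
      exact/val_inj.
  by transitivity ((s%:M : 'rV[R]_1) 0 0); [exact: row_mxEr|rewrite mxE eqxx].
by move=> t s /= H; have := FP (v t s); rewrite E0 E1; apply.
Qed.

End Choice.

(** * Normals to a set, and small definable families *)
Section Normals.
Variables (R : realType) (O : forall n : nat, set (set 'rV[R]_n)).
Context {ominO : ominimal O}.

(** A polynomial expression in absolute values, hence visibly definable, for
    which the scalar product is bounded by the product of the norms. *)
Definition l1 m (v : 'rV[R]_m) : R := \sum_i `|v 0 i|.

Lemma l1_ge0 m (v : 'rV[R]_m) : 0 <= l1 v.
Proof. exact: sumr_ge0. Qed.

Lemma coord_le_l1 m (v : 'rV[R]_m) i : `|v 0 i| <= l1 v.
Proof. by rewrite /l1 (bigD1 i)//= lerDl sumr_ge0. Qed.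

Lemma l1_le m (v : 'rV[R]_m) c : (forall i, `|v 0 i| <= c) -> l1 v <= m%:R * c.
Proof.
move=> H; apply: le_trans (ler_sum _ (fun i _ => H i)) _.
by rewrite sumr_const card_ord mulr_natl.
Qed.

Lemma l1D m (v w : 'rV[R]_m) : l1 (v + w) <= l1 v + l1 w.
Proof.
rewrite /l1 -big_split; apply: ler_sum => i _; rewrite mxE; exact: ler_normD.
Qed.

Lemma l1Z m c (v : 'rV[R]_m) : l1 (c *: v) = `|c| * l1 v.
Proof. by rewrite /l1 mulr_sumr; apply: eq_bigr => i _; rewrite mxE normrM. Qed.

Lemma dotv_le m (v w : 'rV[R]_m) : `|dotv v w| <= l1 v * l1 w.
Proof.
rewrite /dotv mulr_suml; apply: le_trans (ler_norm_sum _ _ _) _.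
apply: ler_sum => i _; rewrite normrM ler_wpM2l//; exact: coord_le_l1.
Qed.

Lemma dotvDr m (u v w : 'rV[R]_m) : dotv u (v + w) = dotv u v + dotv u w.
Proof. by rewrite /dotv -big_split; apply: eq_bigr => i _;
    rewrite mxE mulrDr. Qed.

Lemma dotvDl m (u v w : 'rV[R]_m) : dotv (u + v) w = dotv u w + dotv v w.
Proof. by rewrite /dotv -big_split; apply: eq_bigr => i _;
    rewrite mxE mulrDl. Qed.

Lemma dotvZr m c (u v : 'rV[R]_m) : dotv u (c *: v) = c * dotv u v.
Proof. by rewrite /dotv mulr_sumr; apply: eq_bigr => i _;
    rewrite mxE mulrCA. Qed.

Lemma dotvZl m c (u v : 'rV[R]_m) : dotv (c *: u) v = c * dotv u v.
Proof. by rewrite /dotv mulr_sumr; apply: eq_bigr => i _;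
    rewrite mxE mulrA. Qed.

Definition frechet_normal m (G : 'rV[R]_m -> Prop) (z nu : 'rV[R]_m) :=
  G z /\ forall e : R, 0 < e -> exists d, 0 < d /\
    forall z', G z' -> l1 (z' - z) < d -> dotv nu (z' - z) <= e * l1 (z' - z).

(** The closure of the graph of the Frechet normal map, without sequences so
    as to be first order. *)
Definition limiting_normal m (G : 'rV[R]_m -> Prop) (z nu : 'rV[R]_m) :=
  forall e : R, 0 < e -> exists z' nu',
    [/\ l1 (z' - z) < e, l1 (nu' - nu) < e & frechet_normal G z' nu'].

Lemma dfun_l1 N m (F : 'rV[R]_N -> 'rV[R]_m) :
  definable_map O F -> definable_fun O (fun e => l1 (F e)).
Proof. by move=> HF; rewrite /l1; definability. Qed.

Lemma definable_fnormal m (G : 'rV[R]_m -> Prop) N (F H : 'rV[R]_N ->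
    'rV[R]_m) :
  definable O G -> definable_map O F -> definable_map O H ->
      definable O (fun e => frechet_normal G (F e) (H e)).
Proof. by move=> HG HF HH; rewrite /frechet_normal; definability;
    apply: dfun_l1; definability. Qed.

Lemma definable_lnormal m (G : 'rV[R]_m -> Prop) N (F H : 'rV[R]_N ->
    'rV[R]_m) :
  definable O G -> definable_map O F -> definable_map O H ->
      definable O (fun e => limiting_normal G (F e) (H e)).
Proof.
move=> HG HF HH; rewrite /limiting_normal;
    apply: (@definable_ext _ _ _ (fun x =>
  forall e : R, 0 < e -> exists z' nu' : 'rV[R]_m,
    l1 (z' - F x) < e /\ (l1 (nu' - H x) < e /\ frechet_normal G z' nu'))).
  move=> x; split=> Hx e /Hx[z' [nu']].
    by move=> [h1 [h2 h3]]; exists z', nu'.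
  by move=> [h1 h2 h3]; exists z', nu'.
by definability; first [apply: definable_fnormal => //;
    definability | apply: dfun_l1; definability].
Qed.

(** Stands for a derivative of size at most e at t, without asking that it
    exists. *)
Definition calm (h : R -> R) e t :=
  exists d, 0 < d /\ forall u, `|u - t| < d -> `|h u - h t| <= e * `|u - t|.

(** For fixed s and most t the function h (., s) is calm at t, or grows at t
    with slope at least e / 2, or decreases so. By the Fubini argument, if
    calmness fails on an interval, then one of the last two holds on a box;
    integrating over the box contradicts |h (t, s)| <= s for small s. *)
Lemma dense_in_small_calm (h : R -> R -> R) a b : a < b -> definable_fun2 O h ->
  (forall t s, a < t -> t < b -> 0 < s -> `|h t s| <= s) ->
  dense_in a b (fun t => forall e, 0 < e -> ev_right 0 (fun s =>
      calm (h^~ s) e t)).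
Proof.
move=> ab Hh hs; apply: dense_in_contra; first by rewrite /ev_right /calm;
    definability.
move=> c d ac cd db nH.
have [||k [c1 [d1 [cc1 cd1 dd1 Hk]]]] := @itv_countable_cover R O _ c d
  (fun k t => ~ ev_right 0 (fun s => calm (h^~ s) (k.+1%:R^-1) t)) cd.
- by move=> k; rewrite /ev_right /calm; definability.
- move=> t ct td; apply: contrapT => nE; apply: (nH t ct td) => e e0.
  have := near_infty_natSinv_lt (PosNum e0) => -[k _ /(_ k)/= ke].
  apply: contrapT => nev; apply: nE; exists k => H; apply: nev.
  apply: ev_right_sub H => s s0 [x [x0 Hx]]; exists x; split=> // u ut.
  by apply: le_trans (Hx u ut) _; rewrite ler_wpM2r// ltW// ke.
set e : R := k.+1%:R^-1 in Hk.
have e0 : 0 < e by rewrite invr_gt0.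
pose up t s := ev_right t (fun x => e / 2 * (x - t) <= h x s - h t s) /\
  ev_right (- t) (fun x => e / 2 * (t + x) <= h t s - h (- x) s).
pose dn t s := ev_right t (fun x => e / 2 * (x - t) <= h t s - h x s) /\
  ev_right (- t) (fun x => e / 2 * (t + x) <= h (- x) s - h t s).
have Hup : definable2 O up by rewrite /up /ev_right; definability.
have Hdn : definable2 O dn by rewrite /dn /ev_right; definability.
pose ll t s := calm (h^~ s) e t.
have Hll : definable2 O ll by rewrite /ll /calm; definability.
(* For fixed s the three cases follow from the size and sign of the
   derivative. *)
have tri s : 0 < s -> dense_in c1 d1 (fun t => ll t s \/ (up t s \/ dn t s)).
  move=> s0; have Hs : definable_fun1 O (h^~ s) by definability.
  apply: dense_in_sub (dense_in_strict_derive (a := c1) (b := d1) Hs) =>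
      // t _ _ [m Hm].
  have key e' : 0 < e' -> exists x, 0 < x /\ forall u, `|u - t| < x ->
      `|h u s - h t s - m * (u - t)| <= e' * `|u - t|.
    move=> e'0; have [x [x0 Hx]] := Hm e' e'0; exists x; split=> // u ut.
    by apply: Hx => //; rewrite subrr normr0.
  have e2 : 0 < e / 2 by lra.
  have [x [x0 Hx]] := key _ e2.
  have [me|me] := ltP `|m| e.
    left; have me0 : 0 < e - `|m| by lra.
    have [y [y0 Hy]] := key _ me0; exists y; split=> // u ut.
    rewrite -(subrK (m * (u - t)) (h u s - h t s)).
    apply: le_trans (ler_normD _ _) _.
    by apply: le_trans (lerD (Hy u ut) (lexx _)) _;
        rewrite normrM -mulrDl subrK.
  right; move: me; rewrite ler_normr => /orP[me|me]; [left|right].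
    split; exists x; split=> // u tu ux.
      have uN : `|u - t| = u - t by rewrite gtr0_norm// subr_gt0.
      have /(Hx u) : `|u - t| < x by rewrite uN; lra.
      rewrite uN ler_norml => /andP[h1 _].
      have p : 0 <= u - t by lra.
      have := ler_wpM2r p me; lra.
    have uN : `|- u - t| = u + t by rewrite ltr0_norm; lra.
    have /(Hx (- u)) : `|- u - t| < x by rewrite uN; lra.
    rewrite uN ler_norml => /andP[_ h1].
    have p : 0 <= u + t by lra.
    have := ler_wpM2r p me; lra.
  split; exists x; split=> // u tu ux.
    have uN : `|u - t| = u - t by rewrite gtr0_norm// subr_gt0.
    have /(Hx u) : `|u - t| < x by rewrite uN; lra.
    rewrite uN ler_norml => /andP[_ h1].
    have p : 0 <= u - t by lra.
      have := ler_wpM2r p me; lra.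
  have uN : `|- u - t| = u + t by rewrite ltr0_norm; lra.
  have /(Hx (- u)) : `|- u - t| < x by rewrite uN; lra.
  rewrite uN ler_norml => /andP[h1 _].
  have p : 0 <= u + t by lra.
    have := ler_wpM2r p me; lra.
have g1 : dense_in c1 d1 (fun t => ev_right 0 (fun s => ll t s \/ (up t s \/
    dn t s))).
  by apply: (@dense_in_fubini _ _ _ _ _ _ 1) => //; [definability|move=>
      s s0 _; exact: tri].
have [|c2 [d2 [cc2 cd2 dd2 H2]]] :=
    dense_in_holds_on _ g1 (lexx c1) cd1 (lexx d1).
  by rewrite /ev_right; definability.
have [|||c3 [d3 [cc3 cd3 dd3 H3]]] := @holds_on_cover2 _ _ _ c2 d2
   (fun t => ev_right 0 (up t)) (fun t => ev_right 0 (dn t)) cd2.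
- by rewrite /ev_right; definability.
- by rewrite /ev_right; definability.
- move=> t ct td.
  have nl : ev_right 0 (fun s => ~ ll t s).
    by apply: ev_right_not; [definability|apply: Hk;
        [exact: le_lt_trans ct|exact: lt_le_trans dd2]].
  have ud : ev_right 0 (fun s => up t s \/ dn t s).
    by apply: ev_right_sub (ev_right_and nl (H2 t ct td)) => s _ [nls []].
  have [|?|nu] := @ev_right_dec _ O _ 0 (up t); [by definability|by left|right].
  by apply: ev_right_sub (ev_right_and nu ud) => s _ [nus []].
(* The total growth q over (x, y) is independent of s, while g varies by at most
   2 s. *)
have nogrow (g : R -> R -> R) c4 d4 s0 : c3 <= c4 -> c4 < d4 -> d4 <= d3 ->
    0 < s0 ->
   (forall t s, a < t -> t < b -> 0 < s -> `|g t s| <= s) ->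
   (forall t s, c4 < t -> t < d4 -> 0 < s -> s < s0 ->
     ev_right t (fun x => e / 2 * (x - t) <= g x s - g t s) /\
     ev_right (- t) (fun x => e / 2 * (t + x) <= g t s - g (- x) s)) -> False.
  move=> c34 cd4 d34 s00 gs Hg.
  set x := c4 + (d4 - c4) / 3; set y := c4 + (d4 - c4) * 2 / 3.
  have cx : c4 < x by rewrite /x; lra.
  have yd : y < d4 by rewrite /y; lra.
  have xy : x < y by rewrite /x /y; lra.
  have ac4 : a <= c4 by lra.
  have db4 : d4 <= b by lra.
  have yx0 : 0 < e / 2 * (y - x) by apply: mulr_gt0; lra.
  set q := e / 2 * (y - x) in yx0.
  pose s := Num.min s0 q / 3.
  have m0 : 0 < Num.min s0 q by rewrite lt_min s00.
  have ms0 : Num.min s0 q <= s0 by rewrite ge_min lexx.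
  have ms1 : Num.min s0 q <= q by rewrite ge_min lexx orbT.
  have sgt : 0 < s by rewrite /s; lra.
  have ss0 : s < s0 by rewrite /s; lra.
  have := @local_growth R (fun t => g t s - e / 2 * t) c4 d4 _ _ x y cx xy yd.
  have gx := gs x s (le_lt_trans ac4 cx) (lt_le_trans (lt_trans xy yd) db4) sgt.
  have gy := gs y s (lt_trans (le_lt_trans ac4 cx) xy) (lt_le_trans yd db4) sgt.
  move: gx gy; rewrite !ler_norml => /andP[gx1 gx2] /andP[gy1 gy2].
  move=> H; have : q <= g y s - g x s.
    suff : g x s - e / 2 * x <= g y s - e / 2 * y by rewrite /q; lra.
    apply: H => t ct td; have [h1 h2] := Hg t s ct td sgt ss0.
      by apply: ev_right_sub h1 => u _; lra.
    by move=> e' e'0; apply: ev_right_sub h2 => u _; lra.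
  rewrite /s in gx1 gx2 gy1 gy2; lra.
have ac3 : a <= c3 by lra.
have db3 : d3 <= b by lra.
case: H3 => H3.
  have [|c4 [d4 [s0 [c34 cd4 d34 s00 H4]]]] := ev_right_uniform _ cd3 H3;
      first by definability.
  exact: (nogrow h c4 d4 s0).
have [|c4 [d4 [s0 [c34 cd4 d34 s00 H4]]]] := ev_right_uniform _ cd3 H3;
    first by definability.
apply: (nogrow (fun t s => - h t s) c4 d4 s0) => //.
  by move=> t s ct td sgt; rewrite normrN; exact: hs.
move=> t s ct td sgt ss0; have [h1 h2] := H4 t s ct td sgt ss0.
by split; [apply: ev_right_sub h1|apply: ev_right_sub h2] => x _; lra.
Qed.

End Normals.

(** * Limiting normals are orthogonal to definable curves *)
Section Key.
Variables (R : realType) (O : forall n : nat, set (set 'rV[R]_n)).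
Context {ominO : ominimal O}.

Definition velocity m (z : R -> 'rV[R]_m) t (zeta : 'rV[R]_m) :=
  forall i, strict_derive (fun u => z u 0 i) t (zeta 0 i).

Lemma ev_right_ord a k (A : R -> 'I_k -> Prop) :
  (forall i, ev_right a (A ^~ i)) -> ev_right a (fun x => forall i, A x i).
Proof.
elim: k A => [|k IHk] A HA; first by exists 1; split=> // x _ _ [].
apply: ev_right_sub (ev_right_and (HA ord0) (IHk _ (fun i =>
    HA (lift ord0 i)))).
by move=> x _ [Ax0 AxS] i; case: (unliftP ord0 i) => [j|] ->.
Qed.

(** The increments of w are those of z up to those of w - z, which is calm. *)
Lemma displaced_velocity m (z w : R -> 'rV[R]_m) t zeta e : 0 < e ->
  velocity z t zeta -> (forall i, calm (fun u => w u 0 i - z u 0 i) e t) ->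
  ev_right 0 (fun x => forall u, `|u - t| < x ->
    l1 (w u - w t - (u - t) *: zeta) <= m%:R * (2 * e * `|u - t|)).
Proof.
move=> e0 Hv Hl.
suff H : ev_right 0 (fun x => forall i u, `|u - t| < x ->
   `|(w u - w t - (u - t) *: zeta) 0 i| <= 2 * e * `|u - t|).
  by apply: ev_right_sub H => x _ Hx u ut; apply: l1_le => i; exact: Hx.
apply: ev_right_ord => i.
have [d1 [d10 H1]] := Hv i e e0; have [d2 [d20 H2]] := Hl i.
exists (Num.min d1 d2); split; first by rewrite lt_min d10.
move=> x x0; rewrite add0r lt_min => /andP[xd1 xd2] u ut.
have h1 := H1 t u; have {}h1 := h1 _ (lt_trans ut xd1).
have {}h1 : `|z u 0 i - z t 0 i - zeta 0 i * (u - t)| <= e * `|u - t|.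
  by apply: h1; rewrite subrr normr0.
have h2 := H2 u (lt_trans ut xd2).
rewrite !mxE.
set A := z u 0 i - z t 0 i - zeta 0 i * (u - t) in h1.
set B := (X in `|X|) in h2.
set L := (X in `|X| <= _); have -> : L = A + B by rewrite /L /A /B; ring.
apply: le_trans (ler_normD _ _) _; lra.
Qed.

(** Test the normal inequality at w t against the points w (t + h) and w (t - h)
    for small h: the first-order terms bound the scalar product from both
    sides. *)
Lemma frechet_normal_velocity m (G : 'rV[R]_m -> Prop) (z w : R ->
    'rV[R]_m) t zeta nu e K :
  0 < e -> e <= 1 -> l1 zeta <= K -> l1 nu <= K + 1 -> velocity z t zeta ->
  (forall i, calm (fun u => w u 0 i - z u 0 i) e t) ->
  ev_right 0 (fun x => forall u, `|u - t| < x -> G (w u)) ->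
  frechet_normal G (w t) nu ->
  `|dotv nu zeta| <= e * (K + 2 * m%:R + 2 * m%:R * (K + 1)).
Proof.
move=> e0 e1 zK nK Hv Hl HG [_ Hn].
have [d [d0 Hd]] := Hn e e0.
have K0 : 0 <= K by apply: le_trans zK; exact: l1_ge0.
set M : R := m%:R; have M0 : 0 <= M by exact: ler0n.
set C := K + 2 * M.
have C0 : 0 <= C by rewrite /C; lra.
have Hx : ev_right 0 (fun x => x < d / (C + 1)).
  by apply: ev_right_lt; rewrite divr_gt0// ltr_wpDl.
have [x x0 [[H1 H2] H3]] := ev_right_ex (ev_right_and (ev_right_and
    (displaced_velocity e0 Hv Hl) HG) Hx).
have main u : `|u - t| < x -> (u - t) * dotv nu zeta <= e * (C + 2 * M * (K +
    1)) * `|u - t|.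
  move=> ut; set r := w u - w t - (u - t) *: zeta.
  have lr : l1 r <= M * (2 * e * `|u - t|) := H1 u ut.
  have wE : w u - w t = r + (u - t) *: zeta by rewrite /r subrK.
  set T := `|u - t| in ut lr *; have T0 : 0 <= T by exact: normr_ge0.
  have lw : l1 (w u - w t) <= C * T.
    rewrite wE; apply: le_trans (l1D _ _) _; rewrite l1Z -/T /C mulrDl addrC.
    apply: lerD; first by rewrite mulrC ler_wpM2r.
    apply: le_trans lr _; rewrite mulrA [M * _]mulrC -!mulrA.
    have h : e * (M * T) <= 1 * (M * T) by apply: ler_wpM2r => //;
        exact: mulr_ge0.
    by rewrite mul1r in h; rewrite !mulrA in h *; lra.
  have lwd : l1 (w u - w t) < d.
    apply: le_lt_trans lw _; have : (C + 1) * T < d.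
      by rewrite mulrC -ltr_pdivlMr ?ltr_wpDl//; exact: lt_trans H3.
    by apply: le_lt_trans; rewrite ler_wpM2r// lerDl.
  have h1 := Hd _ (H2 u ut) lwd.
  have {}h1 : dotv nu (w u - w t) <= e * (C * T).
    by apply: le_trans h1 _; rewrite ler_pM2l.
  have h2 : - dotv nu r <= (K + 1) * (M * (2 * e * T)).
    apply: le_trans (ler_norm _) _; rewrite normrN.
    apply: le_trans (dotv_le _ _) _.
    by apply: ler_pM => //; exact: l1_ge0.
  move: h1; rewrite wE dotvDr dotvZr.
  set X := (u - t) * _; lra.
have x2 : 0 < x / 2 by lra.
have xx : x / 2 < x by lra.
have E1 : t + x / 2 - t = x / 2 by lra.
have E2 : t - x / 2 - t = - (x / 2) by lra.
have h1 := main (t + x / 2); rewrite E1 (gtr0_norm x2) [X in _ ->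
    X <= _]mulrC in h1.
have h2 := main (t - x / 2).
rewrite E2 normrN (gtr0_norm x2) mulNr -mulrN [X in _ -> X <= _]mulrC in h2.
have {}h1 := h1 xx; have {}h2 := h2 xx.
rewrite ler_pM2r// in h1; rewrite ler_pM2r// in h2.
by rewrite ler_norml; apply/andP; split; [rewrite lerNl|].
Qed.

(** On an interval where this fails, one constant K bounds the velocity zeta
    and the bad normal nu and keeps their scalar product away from 0. Frechet
    normals close to nu, at points of G on a nearby definable curve with
    nearly the same velocity, make that scalar product arbitrarily small. *)
Lemma limiting_normal_curve m (G : 'rV[R]_m -> Prop) (z : R -> 'rV[R]_m) a b :
  definable O G -> definable_curve O z ->
  dense_in a b (fun t => forall zeta nu : 'rV[R]_m, velocity z t zeta ->
    limiting_normal G (z t) nu -> dotv nu zeta = 0).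
Proof.
move=> HG Hz.
have Hvel N (F : 'rV[R]_N -> R) (V : 'rV[R]_N -> 'rV[R]_m) :
    definable_fun O F ->
    definable_map O V -> definable O (fun e => velocity z (F e) (V e)).
  by move=> HF HV; rewrite /velocity /strict_derive; definability.
have Hln N (F : 'rV[R]_N -> R) (V : 'rV[R]_N -> 'rV[R]_m) : definable_fun O F ->
    definable_map O V -> definable O (fun e =>
        limiting_normal G (z (F e)) (V e)).
  by move=> HF HV; apply: definable_lnormal => //; definability.
apply: dense_in_contra.
  by definability; first [apply: Hvel|apply: Hln]; definability.
move=> c d ac cd db bad.
pose W k t := exists zeta nu : 'rV[R]_m, velocity z t zeta /\
    (limiting_normal G (z t) nu /\
  (l1 zeta <= k /\ (l1 nu <= k /\ 1 <= k * `|dotv nu zeta|))).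
have [||k [c1 [d1 [cc cd1 dd Hk]]]] := @itv_countable_cover R O _ c d
  (fun k => W k%:R) cd.
- by move=> k; rewrite /W; definability;
    first [apply: Hvel|apply: Hln|apply: dfun_l1]; definability.
- move=> t ct td; apply: contrapT => nW; apply: (bad t ct td) => zeta nu Hv Hn.
  apply: contrapT => /eqP ne; apply: nW.
  (* A natural number above q serves as the bound k in W. *)
  pose q := l1 zeta + l1 nu + `|dotv nu zeta|^-1.
  have q0 : 0 <= q by rewrite /q !addr_ge0 ?l1_ge0 ?invr_ge0.
  have qk := archi_boundP q0; exists (Num.bound q); exists zeta, nu.
  have := l1_ge0 zeta; have := l1_ge0 nu.
  have : 0 <= `|dotv nu zeta|^-1 by rewrite invr_ge0.
  rewrite /q in qk; split=> //; split=> //; split; first lra; split; first lra.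
  rewrite -ler_pdivrMr ?normr_gt0// mul1r; lra.
set K : R := k%:R in Hk; have K0 : 0 <= K by exact: ler0n.
have [|V HV VP] := @choice_curve R O _ (m + m) (fun t y =>
  velocity z t (lsubmx y) /\ (limiting_normal G (z t) (rsubmx y) /\
  (l1 (lsubmx y) <= K /\ (l1 (rsubmx y) <= K /\
      1 <= K * `|dotv (rsubmx y) (lsubmx y)|)))).
  by definability; first [apply: Hvel|apply: Hln|apply: dfun_l1]; definability.
have Vex t : c1 < t -> t < d1 -> exists y : 'rV_(m + m),
    velocity z t (lsubmx y) /\
  (limiting_normal G (z t) (rsubmx y) /\ (l1 (lsubmx y) <= K /\
  (l1 (rsubmx y) <= K /\ 1 <= K * `|dotv (rsubmx y) (lsubmx y)|))).
  move=> ct td; have [zeta [nu H]] := Hk t ct td; exists (row_mx zeta nu).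
  by rewrite row_mxKl row_mxKr.
have [|w Hw wP] := @choice_surface R O _ (m + m) (fun t s y =>
  l1 (lsubmx y - z t) < s /\ (l1 (rsubmx y - rsubmx (V t)) < s /\
  frechet_normal G (lsubmx y) (rsubmx y))).
  by definability; first [apply: definable_fnormal => //|apply: dfun_l1];
      definability.
have {}wP t s : c1 < t -> t < d1 -> 0 < s -> [/\ l1 (lsubmx (w t s) - z t) < s,
    l1 (rsubmx (w t s) - rsubmx (V t)) < s &
    frechet_normal G (lsubmx (w t s)) (rsubmx (w t s))].
  move=> ct td s0; have [_ [Hn _]] := VP t (Vex t ct td).
  have [z' [nu' [h1 h2 h3]]] := Hn s s0.
  have [|? []] := wP t s; first by exists (row_mx z' nu');
      rewrite row_mxKl row_mxKr.
  by split.
pose h i t s := lsubmx (w t s) 0 i - z t 0 i.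
have Hh i : definable_fun2 O (h i) by rewrite /h; definability.
have hs i t s : c1 < t -> t < d1 -> 0 < s -> `|h i t s| <= s.
  move=> ct td s0; have [h1 _ _] := wP t s ct td s0; apply: le_trans (ltW h1).
  have -> : h i t s = (lsubmx (w t s) - z t) 0 i by rewrite /h !mxE.
  exact: coord_le_l1.
have gh : dense_in c1 d1 (fun t => forall i e, 0 < e ->
    ev_right 0 (fun s => calm (h i ^~ s) e t)).
  apply: dense_in_ord => i; have Hhi := Hh i; first by rewrite /calm /ev_right;
      definability.
  by apply: dense_in_small_calm => //; exact: hs.
have [t [ct td Ht]] := gh c1 d1 (lexx _) cd1 (lexx _).
have [Hv [Hn [zK [nK Kd]]]] := VP t (Vex t ct td).
set zeta := lsubmx (V t) in Hv zK Kd; set nu := rsubmx (V t) in Hn nK Kd.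
set C := K + 2 * m%:R + 2 * m%:R * (K + 1).
have C0 : 0 <= C by rewrite /C !addr_ge0 ?mulr_ge0 ?ler0n ?addr_ge0.
(* C is the constant of the estimate for e; this e gives K |<nu, zeta>| <= 1
   / 2. *)
pose e := Num.min 1 ((K * (C + K) + 1)^-1 / 2).
have P0 : 0 < K * (C + K) + 1 by rewrite ltr_wpDl// mulr_ge0// addr_ge0.
have e0 : 0 < e by rewrite lt_min ltr01/= divr_gt0 ?invr_gt0.
have e1 : e <= 1 by rewrite ge_min lexx.
have eP : e <= (K * (C + K) + 1)^-1 / 2 by rewrite ge_min lexx orbT.
have [s s0 [Hs se]] := ev_right_ex (ev_right_and (ev_right_ord (fun i =>
    Ht i e e0)) (ev_right_lt e0)).
have [w1 w2 w3] := wP t s ct td s0.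
have nuK : l1 (rsubmx (w t s)) <= K + 1.
  rewrite -(subrK nu (rsubmx (w t s))); apply: le_trans (l1D _ _) _.
  rewrite addrC; apply: lerD => //; apply: le_trans (ltW w2) _; lra.
have Gw : ev_right 0 (fun x => forall u, `|u - t| < x -> G (lsubmx (w u s))).
  exists (Num.min (t - c1) (d1 - t)); split;
      first by rewrite lt_min !subr_gt0 ct.
  move=> x x0; rewrite add0r lt_min => /andP[x1 x2] u; rewrite ltr_norml =>
      /andP[u1 u2].
  have cu : c1 < u by lra.
  have ud : u < d1 by lra.
  by have [_ _ []] := wP u s cu ud s0.
have D1 := @frechet_normal_velocity m G z (fun u =>
    lsubmx (w u s)) t zeta _ e K e0 e1
  zK nuK Hv Hs Gw w3.
have D2 : `|dotv nu zeta| <= e * (C + K).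
  rewrite mulrDr -(subKr (rsubmx (w t s)) nu) dotvDl.
  apply: le_trans (ler_normD _ _) _; apply: lerD; first exact: D1.
  apply: le_trans (dotv_le _ _) _; apply: ler_pM => //; try exact: l1_ge0.
  by rewrite -scaleN1r l1Z normrN1 mul1r; lra.
have : K * `|dotv nu zeta| <= e * (K * (C + K)).
  by rewrite mulrCA; exact: ler_wpM2l.
have : e * (K * (C + K)) <= e * (K * (C + K) + 1) by rewrite ler_pM2l// lerDl.
have : e * (K * (C + K) + 1) <= 1 / 2.
  by rewrite -ler_pdivlMr// mulrC mul1r.
lra.
Qed.
End Key.

(** * Calculus of strict derivatives *)
Section StrictDerivative.
Variable R : realType.
Implicit Types (g : R -> R) (a b c t : R).

Lemma strict_derive_cvg g t c : strict_derive g t c ->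
  h^-1 *: ((g \o shift t) (h *: (1 : R)) - g t) @[h --> 0^'] --> c.
Proof.
move=> Hg; apply/cvgrPdist_le => e e0; have [d [d0 Hd]] := Hg e e0.
near=> h.
have h0 : h != 0 by near: h; exact: nbhs_dnbhs_neq.
have hd : `|h| < d by near: h; exact: dnbhs0_lt.
have := Hd t (h + t); rewrite subrr normr0 addrK => /(_ d0 hd).
rewrite /= scaler1 -[X in `|c - X|]/(h^-1 * (g (h + t) - g t)) => H.
rewrite -[X in `|X - _|](mulKf h0) -mulrBr normrM normfV.
by rewrite ler_pdivrMl ?normr_gt0// distrC [h * c]mulrC [`|h| * e]mulrC.
Unshelve. all: by end_near.
Qed.

Lemma strict_derive_derivable g t c : strict_derive g t c -> derivable g t 1.
Proof. by move=> /strict_derive_cvg; exact: cvgP. Qed.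

Lemma strict_derive_derive1 g t c : strict_derive g t c -> derive1 g t = c.
Proof. by move=> /strict_derive_cvg; rewrite derive1E; exact: cvg_lim. Qed.

Lemma strict_derive_uniq g t c c' : strict_derive g t c ->
    strict_derive g t c' -> c = c'.
Proof. by move=> /strict_derive_derive1 <- /strict_derive_derive1. Qed.

(** Strict derivatives at two nearby points are compared through a common
    increment. *)
Lemma strict_derive_slope g t c e : strict_derive g t c -> 0 < e -> exists d,
    0 < d /\
  forall x c', `|x - t| < d -> strict_derive g x c' -> `|c' - c| <= e.
Proof.
move=> Hg e0; have e2 : 0 < e / 2 by lra.
have [d [d0 Hd]] := Hg _ e2; exists d; split=> // x c' xt Hx.
have [d' [d'0 Hd']] := Hx _ e2.
set m := Num.min (d - `|x - t|) d'.
have m0 : 0 < m by rewrite lt_min subr_gt0 xt.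
have m1 : m <= d - `|x - t| by rewrite ge_min lexx.
have m2 : m <= d' by rewrite ge_min lexx orbT.
pose y := x + m / 2; have yx : y - x = m / 2 by rewrite /y; lra.
have mm : 0 < m / 2 by lra.
have yt : `|y - t| < d.
  have -> : y - t = (x - t) + m / 2 by rewrite /y; lra.
  by apply: le_lt_trans (ler_normD _ _) _; rewrite (gtr0_norm mm); lra.
have h1 := Hd x y xt yt.
have h2 := Hd' x y; rewrite subrr normr0 yx (gtr0_norm mm) in h2.
have {}h2 := h2 d'0 (ltac:(lra)).
rewrite yx (gtr0_norm mm) in h1.
rewrite -(ler_pM2r mm) -{1}(gtr0_norm mm) -normrM.
set A := g y - g x in h1 h2.
have -> : (c' - c) * (m / 2) = (A - c * (m / 2)) - (A - c' * (m / 2)) by ring.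
apply: le_trans (ler_normB _ _) _; lra.
Qed.

Lemma derive1_continuous g t a b : a < t -> t < b ->
  (forall x, a < x -> x < b -> exists c, strict_derive g x c) ->
  {for t, continuous (derive1 g)}.
Proof.
move=> at_ tb H; have [c Hc] := H t at_ tb.
rewrite /prop_for /continuous_at (strict_derive_derive1 Hc).
apply/cvgrPdist_le => e e0; have [d [d0 Hd]] := strict_derive_slope Hc e0.
near=> x.
have : x \in `]a, b[.
  by near: x; apply: near_in_itvoo; rewrite in_itv /= at_.
rewrite in_itv /= => /andP[ax xb].
have xt : `|x - t| < d.
  rewrite distrC; near: x; exact: cvgr_dist_lt.
have [c' Hc'] := H x ax xb; rewrite (strict_derive_derive1 Hc') distrC;
    exact: Hd Hc'.
Unshelve. all: by end_near.
Qed.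

Lemma strict_derive_lcont g t c : strict_derive g t c -> lcont g t.
Proof.
move=> /(_ 1 ltr01)[d [d0 Hd]] e e0.
have k0 : 0 < `|c| + 1 by rewrite ltr_wpDl.
exists (Num.min d (e / (`|c| + 1))); split; first by rewrite lt_min d0 divr_gt0.
move=> x tx; rewrite -ltrBlDl lt_min => /andP[xd xe].
have txN : - x - t < 0 by lra.
have uN : `|- x - t| = x - - t by rewrite ltr0_norm; lra.
have := Hd t (- x); rewrite subrr normr0 uN => /(_ d0 xd) h1.
rewrite ltr_pdivlMr// in xe.
rewrite -(subrK (c * (- x - t)) (g (- x) - g t)).
apply: le_lt_trans (ler_normD _ _) _; rewrite normrM uN.
by apply: le_lt_trans (lerD h1 (lexx _)) _; lra.
Qed.

(** The mean value inequality, through local growth with slope k - q for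
    every q > 0. *)
Lemma strict_derive_growth g a b k :
  (forall t, a < t -> t < b -> exists2 c, k <= c & strict_derive g t c) ->
  forall x y, a < x -> x <= y -> y < b -> k * (y - x) <= g y - g x.
Proof.
move=> H x y ax; rewrite le_eqVlt => /orP[/eqP ->|xy yb].
  by rewrite !subrr mulr0.
apply/ler_addgt0Pr => e e0; have yx : 0 < y - x by lra.
pose q := e / (y - x); have q0 : 0 < q by rewrite divr_gt0.
suff : (k - q) * (y - x) <= g y - g x by rewrite mulrBl /q mulfVK ?gt_eqF//;
    lra.
apply: (@slope_le R g _ a b) => // t at_ tb; have [c kc Hc] := H t at_ tb.
  exact: strict_derive_lcont Hc.
have [d [d0 Hd]] := Hc _ q0; exists d; split=> // u tu ud.
have uN : `|u - t| = u - t by rewrite gtr0_norm; lra.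
have := Hd t u; rewrite subrr normr0 uN => /(_ d0 (ltac:(lra))).
have p : 0 <= u - t by lra.
by rewrite ler_norml => /andP[h1 _]; have := ler_wpM2r p kc; lra.
Qed.

Lemma strict_derive_add g1 g2 t c1 c2 : strict_derive g1 t c1 ->
    strict_derive g2 t c2 ->
  strict_derive (fun x => g1 x + g2 x) t (c1 + c2).
Proof.
move=> H1 H2 e e0; have e2 : 0 < e / 2 by lra.
have [d1 [d10 Hd1]] := H1 _ e2; have [d2 [d20 Hd2]] := H2 _ e2.
exists (Num.min d1 d2); split; first by rewrite lt_min d10.
move=> x y; rewrite !lt_min => /andP[x1 x2] /andP[y1 y2].
have h1 := Hd1 x y x1 y1; have h2 := Hd2 x y x2 y2.
set A := (X in `|X|) in h1; set B := (X in `|X|) in h2.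
have -> : g1 y + g2 y - (g1 x + g2 x) - (c1 + c2) * (y - x) = A + B.
  by rewrite /A /B; ring.
by apply: le_trans (ler_normD _ _) _; lra.
Qed.

Lemma strict_derive_cst k t : strict_derive (fun=> k) t 0.
Proof.
move=> e e0; exists 1; split=> // x y _ _.
by rewrite /= subrr mul0r subr0 normr0; apply: mulr_ge0 => //; exact: ltW.
Qed.

Lemma strict_derive_id t : strict_derive id t 1.
Proof.
move=> e e0; exists 1; split=> // x y _ _.
by rewrite /= mul1r subrr normr0; apply: mulr_ge0 => //; exact: ltW.
Qed.

Lemma strict_derive_scale k g t c : strict_derive g t c ->
    strict_derive (fun x => k * g x) t (k * c).
Proof.
move=> Hg e e0; have k0 : 0 < `|k| + 1 by rewrite ltr_wpDl.
have [d [d0 Hd]] := Hg (e / (`|k| + 1)) (divr_gt0 e0 k0).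
exists d; split=> // x y xt yt; have h := Hd x y xt yt.
have -> : k * g y - k * g x - k * c * (y - x) = k * (g y - g x - c * (y - x))
    by ring.
rewrite normrM; apply: le_trans (ler_wpM2l (normr_ge0 _) h) _.
by rewrite mulrA ler_wpM2r// mulrA ler_pdivrMr// mulrC ler_pM2l// lerDl.
Qed.

Lemma strict_derive_sum k (G : 'I_k -> R -> R) t (C : 'I_k -> R) :
  (forall i, strict_derive (G i) t (C i)) -> strict_derive (fun x =>
      \sum_i G i x) t (\sum_i C i).
Proof.
elim: k G C => [|k IHk] G C HG.
  rewrite big_ord0 (_ : (fun x => _) = (fun=> 0));
      first exact: strict_derive_cst.
  by apply/funext => x; rewrite big_ord0.
rewrite big_ord_recl (_ : (fun x => _) =
    (fun x => G ord0 x + \sum_i G (lift ord0 i) x)).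
  by apply: strict_derive_add => //; exact: IHk.
by apply/funext => x; rewrite big_ord_recl.
Qed.

Lemma strict_derive_near g1 g2 a b t c : a < t -> t < b ->
  (forall x, a < x -> x < b -> g1 x = g2 x) -> strict_derive g1 t c ->
      strict_derive g2 t c.
Proof.
move=> at_ tb E H e e0; have [d [d0 Hd]] := H e e0.
exists (Num.min d (Num.min (t - a) (b - t))); split.
  by rewrite !lt_min d0 !subr_gt0 at_.
move=> x y; rewrite !lt_min => /andP[xd /andP[xa xb]] /andP[yd /andP[ya yb]].
move: xa xb ya yb; rewrite !ltr_norml =>
    /andP[? ?] /andP[? ?] /andP[? ?] /andP[? ?].
by rewrite -!E; [exact: Hd|lra..].
Qed.
End StrictDerivative.

(** * Subgradients as normals to the graph *)
Section Subdifferentials.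
Variable R : realType.

Lemma dotvNl n (u v : 'rV[R]_n) : dotv (- u) v = - dotv u v.
Proof. by rewrite -scaleN1r dotvZl mulN1r. Qed.

Lemma dotv_row n k (a c : 'rV[R]_n) (b d : 'rV[R]_k) :
  dotv (row_mx a b) (row_mx c d) = dotv a c + dotv b d.
Proof.
rewrite /dotv big_split_ord /=; congr (_ + _); apply: eq_bigr => i _.
  by rewrite !row_mxEl.
by rewrite !row_mxEr.
Qed.

Lemma dotv_scalar (a b : R) : dotv (a%:M : 'rV_1) b%:M = a * b.
Proof. by rewrite /dotv big_ord1 !mxE eqxx. Qed.

Lemma l1_row n k (a : 'rV[R]_n) (b : 'rV[R]_k) : l1 (row_mx a b) = l1 a + l1 b.
Proof.
rewrite /l1 big_split_ord /=; congr (_ + _); apply: eq_bigr => i _.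
  by rewrite row_mxEl.
by rewrite row_mxEr.
Qed.

Lemma l1_scalar (a : R) : l1 (a%:M : 'rV_1) = `|a|.
Proof. by rewrite /l1 big_ord1 mxE eqxx. Qed.

Lemma row_scalarB n (a c : 'rV[R]_n) (b d : R) :
  row_mx a b%:M - row_mx c d%:M = row_mx (a - c) ((b - d)%:M : 'rV_1).
Proof. by rewrite opp_row_mx add_row_mx raddfB. Qed.

Lemma dotv_ge0 n (v : 'rV[R]_n) : 0 <= dotv v v.
Proof. by apply: sumr_ge0 => i _; rewrite -expr2 sqr_ge0. Qed.

Lemma enorm_ge0 n (v : 'rV[R]_n) : 0 <= enorm v.
Proof. exact: sqrtr_ge0. Qed.

Lemma sqr_enorm n (v : 'rV[R]_n) : enorm v ^+ 2 = dotv v v.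
Proof. by rewrite sqr_sqrtr// dotv_ge0. Qed.

Lemma enorm_le_l1 n (v : 'rV[R]_n) : enorm v <= l1 v.
Proof.
rewrite -(@ler_pXn2r _ 2) ?nnegrE ?enorm_ge0 ?l1_ge0// sqr_enorm expr2.
exact: le_trans (ler_norm _) (dotv_le _ _).
Qed.

Lemma coord_le_enorm n (v : 'rV[R]_n) i : `|v 0 i| <= enorm v.
Proof.
rewrite -(@ler_pXn2r _ 2) ?nnegrE ?enorm_ge0// sqr_enorm real_normK ?num_real//.
rewrite /dotv (bigD1 i)//= expr2 lerDl; apply: sumr_ge0 => j _.
by rewrite -expr2 sqr_ge0.
Qed.

Lemma dotv_le_enorm n (p v : 'rV[R]_n) : `|dotv p v| <= enorm p * l1 v.
Proof.
rewrite /dotv mulr_sumr; apply: le_trans (ler_norm_sum _ _ _) _.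
apply: ler_sum => i _; rewrite normrM ler_wpM2r//; exact: coord_le_enorm.
Qed.

Lemma enorm_gt0 n (v : 'rV[R]_n) : v != 0 -> 0 < enorm v.
Proof.
move=> v0; rewrite lt_def enorm_ge0 andbT; apply: contra_neq v0 => e0.
apply/rowP => i; rewrite mxE; apply/eqP; rewrite -normr_le0 -e0.
exact: coord_le_enorm.
Qed.

(** The two lemmas below translate between the topology, given by the sup
    norm, and l1 balls. *)
Lemma nbhs_l1 n (x : 'rV[R]_n) (P : set 'rV[R]_n) : nbhs x P ->
  exists d, 0 < d /\ forall y, l1 (y - x) < d -> P y.
Proof.
move=> /nbhs_ballP[d /= d0 Hd]; exists d; split=> // y yx; apply: Hd.
split=> // i j; rewrite ord1 /ball /= distrC.
have -> : y 0 j - x 0 j = (y - x) 0 j by rewrite !mxE.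
exact: le_lt_trans (coord_le_l1 _ j) yx.
Qed.

Lemma l1_nbhs n (x : 'rV[R]_n) e : 0 < e -> \forall y \near x, l1 (y - x) < e.
Proof.
move=> e0; pose q : R := e / (n%:R + 1).
have n1 : 0 < n%:R + 1 :> R by rewrite ltr_wpDl.
have q0 : 0 < q by rewrite divr_gt0.
apply/nbhs_ballP; exists q => //= y [_ Hy].
have : l1 (y - x) <= n%:R * q.
  apply: l1_le => i; rewrite !mxE distrC; apply: ltW; exact: (Hy 0 i).
move=> /le_lt_trans; apply; rewrite /q mulrA ltr_pdivrMr// mulrC ltr_pM2l//.
by rewrite ltrDl.
Qed.

Variables (n : nat) (f : 'rV[R]_n -> \bar R).
Hypothesis f_gtNy : forall x, (-oo < f x)%E.
Local Notation G := (egraph f).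
Local Notation pt x := (row_mx x (fine (f x))%:M).

Lemma dom_fin x : dom f x -> f x = (fine (f x))%:E.
Proof. by move=> fx; rewrite fineK// fin_real// f_gtNy. Qed.

(** Stated between real numbers: where f is infinite the lower bound is no
    constraint. *)
Lemma frechet_ineq x p : frechet_subdiff f x p -> forall e, 0 < e ->
  exists d, 0 < d /\ forall y, dom f y -> l1 (y - x) < d ->
    - (e * enorm (y - x)) <= fine (f y) - fine (f x) - dotv p (y - x).
Proof.
move=> [fx]; rewrite limf_einfE => H e e0.
have : ((- e)%:E < ereal_sup [set ereal_inf [set
    ((f y - f x - (dotv p (y - x))%:E) * ((enorm (y - x))^-1)%:E)%E | y in V] |
    V in x^'])%E.
  by apply: lt_le_trans H; rewrite lte_fin oppr_lt0.
move=> /ereal_sup_gt[_ [V HV <-] HVe].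
have [d [d0 Hd]] := nbhs_l1 HV; exists d; split=> // y fy yx.
have [->|yx0] := eqVneq y x.
  rewrite !subrr (_ : dotv p 0 = 0) ?subrr ?oppr_le0 ?mulr_ge0 ?enorm_ge0
      ?ltW//.
  by rewrite /dotv big1// => i _; rewrite mxE mulr0.
have n0 : 0 < enorm (y - x) by rewrite enorm_gt0// subr_eq0.
have := lt_le_trans HVe (ereal_inf_lbound _).
move=> /(_ _ (ex_intro2 _ _ y (Hd y yx yx0) erefl)).
rewrite (dom_fin fy) (dom_fin fx) -!EFinB -EFinM lte_fin.
by rewrite ltr_pdivlMr// mulNr => /ltW.
Qed.

(** A tangent lower bound for f at x makes (p, -1) a normal to the epigraph,
    hence to the graph; scaling by tau prepares for horizontal limits. *)
Lemma frechet_subdiff_normal x p tau : 0 < tau -> frechet_subdiff f x p ->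
  frechet_normal G (pt x) (row_mx (tau *: p) (- tau)%:M).
Proof.
move=> tau0 Hp; split; first by exists x => //; case: Hp.
move=> e e0; have [d [d0 Hd]] := frechet_ineq Hp (divr_gt0 e0 tau0).
exists d; split=> // _ [y fy <-].
rewrite row_scalarB l1_row l1_scalar dotv_row dotv_scalar dotvZl => yx.
have {}yx : l1 (y - x) < d.
  by apply: le_lt_trans yx; rewrite lerDl.
have h := Hd y fy yx.
have h2 := enorm_le_l1 (y - x).
set N := enorm _ in h h2; set D := dotv _ _ in h *; set L := l1 _ in h2 *.
set F := fine (f y) - fine (f x) in h *.
have : tau * (D - F) <= tau * (e / tau * N) by rewrite ler_pM2l//; lra.
have -> : tau * (e / tau * N) = e * N by rewrite mulrA mulrCA divff ?gt_eqF
    ?mulr1.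
have : e * N <= e * (L + `|F|).
  by rewrite ler_pM2l//; apply: le_trans h2 _; rewrite lerDl.
rewrite mulrBr mulNr; lra.
Qed.

(** Covers limiting subgradients, with tau = 1, and asymptotic ones, with tau
    tending to 0. *)
Lemma limiting_normal_of_limit x (u us : nat -> 'rV[R]_n) (tau : nat -> R) a q :
  dom f x -> (forall k, frechet_subdiff f (u k) (us k)) ->
  (forall k, 0 < tau k) -> tau @ \oo --> a -> u @ \oo --> x ->
  (fun k => f (u k)) @ \oo --> f x -> (fun k => tau k *: us k) @ \oo --> q ->
  limiting_normal G (pt x) (row_mx q (- a)%:M).
Proof.
move=> fx Hus tau0 tau_a u_x fu_fx us_q e e0.
have e2 : 0 < e / 2 by lra.
rewrite (dom_fin fx) in fu_fx.
have H1 : \forall k \near \oo, `|fine (f x) - fine (f (u k))| < e / 2.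
  exact: ((cvgrPdist_lt _ _).1 (fine_cvg fu_fx) _ e2).
have H2 : \forall k \near \oo, `|a - tau k| < e / 2.
  exact: ((cvgrPdist_lt _ _).1 tau_a _ e2).
have H3 : \forall k \near \oo, l1 (u k - x) < e / 2.
  exact: u_x (l1_nbhs x e2).
have H4 : \forall k \near \oo, l1 (tau k *: us k - q) < e / 2.
  exact: us_q (l1_nbhs q e2).
have [k [[h1 h2] [h3 h4]]] : exists k,
    (`|fine (f x) - fine (f (u k))| < e / 2 /\
    `|a - tau k| < e / 2) /\ (l1 (u k - x) < e / 2 /\
        l1 (tau k *: us k - q) < e / 2).
  have [k [[? ?] [? ?]]] := filter_ex (filterI (filterI H1 H2) (filterI H3 H4)).
  by exists k.
exists (pt (u k)), (row_mx (tau k *: us k) (- tau k)%:M); split.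
- by rewrite row_scalarB l1_row l1_scalar distrC; lra.
- by rewrite row_scalarB l1_row l1_scalar opprK addrC [- tau k + a]addrC; lra.
exact: frechet_subdiff_normal.
Qed.

Lemma limiting_subdiff_normal x p : limiting_subdiff f x p ->
  limiting_normal G (pt x) (row_mx p (- 1)%:M).
Proof.
move=> [fx [u [us [Hus ux fux usp]]]].
apply: (@limiting_normal_of_limit x u us (fun=> 1)) => //; first exact: cvg_cst.
by rewrite (_ : (fun k => 1 *: us k) = us)//; apply/funext => k;
    rewrite scale1r.
Qed.

Lemma asymptotic_subdiff_normal x q : asymptotic_subdiff f x q ->
  limiting_normal G (pt x) (row_mx q (- 0)%:M).
Proof.
move=> [fx [u [us [t [Hus [t0 _ tl] ux fux usp]]]]].
exact: (@limiting_normal_of_limit x u us t).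
Qed.

Lemma hyperplane_convex (w : 'rV[R]_n) c :
  @convex_set R 'rV[R]_n [set p | dotv p w = c].
Proof.
move=> x y l; rewrite !inE /= => xc yc.
rewrite /conv /= dotvDl !dotvZl xc yc -mulrDl.
by rewrite addrC subrK mul1r.
Qed.

Lemma hyperplane_closure (w : 'rV[R]_n) c :
  closure [set p | dotv p w = c] `<=` [set p | dotv p w = c].
Proof.
move=> p Hp /=; apply/eqP; rewrite -subr_eq0 -normr_le0.
apply/ler_addgt0Pr => e e0; rewrite add0r.
have w1 : 0 < l1 w + 1 by rewrite ltr_wpDl// l1_ge0.
have [q [/= <- Hq]] := Hp _ (l1_nbhs p (divr_gt0 e0 w1)).
rewrite distrC -dotvNl -dotvDl; apply: le_trans (dotv_le _ _) _.
apply: le_trans (ler_wpM2r (l1_ge0 _) (ltW Hq)) _.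
by rewrite mulrAC ler_pdivrMr// ler_pM2l// lerDl.
Qed.

(** Against a vector (w, c) orthogonal to all limiting normals, limiting
    subgradients have product c with w and asymptotic ones have product 0. So
    their sums lie in the closed convex set of the p with <p, w> = c, which
    then contains the Clarke subdifferential. *)
Lemma clarke_span x p : clarke_subdiff f x p ->
  forall zeta, (forall nu, limiting_normal G (pt x) nu -> dotv nu zeta = 0) ->
    dotv (row_mx p (- 1)%:M) zeta = 0.
Proof.
move=> Hp zeta; rewrite -(hsubmxK zeta) (row_const (rsubmx zeta)).
set w := lsubmx zeta; set c := rsubmx zeta 0 0 => Hz.
rewrite dotv_row dotv_scalar mulN1r; apply/eqP; rewrite subr_eq0; apply/eqP.
apply: (@hyperplane_closure w c); apply: closure_subset Hp.
apply: smallest_sub; first exact: hyperplane_convex.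
move=> _ [r Hr [q Hq <-]] /=.
have := Hz _ (limiting_subdiff_normal Hr); have :=
    Hz _ (asymptotic_subdiff_normal Hq).
rewrite !dotv_row !dotv_scalar oppr0 mul0r addr0 => q0.
by rewrite dotvDl q0 addr0 mulN1r => /eqP; rewrite subr_eq0 => /eqP.
Qed.

Lemma clarke_dom x p : clarke_subdiff f x p -> dom f x.
Proof.
move=> Hp; apply: contrapT => nfx.
suff E : [set p + q | p in limiting_subdiff f x & q in asymptotic_subdiff f x]
    `<=` set0.
  have H : @convex_set R 'rV[R]_n set0 by move=> a b l; rewrite inE.
  have := smallest_sub H E; move/closure_subset => /(_ p Hp).
  by rewrite closure0.
by move=> t [a [fx _] _]; exact: nfx.
Qed.
End Subdifferentials.

(** * The desingularizing function *)
Section Desingularization.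
Variables (R : realType) (O : forall n : nat, set (set 'rV[R]_n)).
Context {ominO : ominimal O}.

(** The term t makes psi strictly increasing and its derivative positive even
    where phi is stationary; subtracting the infimum of phi makes psi
    continuous at 0. *)
Lemma desingularize (phi : R -> R) (delta B : R) : definable_fun1 O phi ->
    0 < delta ->
  (forall t, 0 < t -> t < delta -> exists2 c, 0 <= c & strict_derive phi t c) ->
  (forall t, 0 < t -> t < delta -> B <= phi t) ->
  exists psi : R -> R,
    [/\ {in `[0, delta[ &, {homo psi : s t / s < t}},
        {within `[0, delta[, continuous psi},
        O (graph_on `[0, delta[ psi),
        (forall t : R, t \in `[0, delta[ -> 0 <= psi t) &
        psi 0 = 0] /\
    forall t, 0 < t -> t < delta ->
      [/\ derivable psi t 1, {for t, continuous (derive1 psi)} &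
          forall c, strict_derive phi t c -> derive1 psi t = 1 + 2 * c].
Proof.
move=> Hphi d0 Hd HB.
pose A := [set y | exists t, [/\ 0 < t, t < delta & y = phi t]].
pose m := inf A.
pose psi t := if `[< 0 < t >] then t + 2 * (phi t - m) else 0.
have A0 : A !=set0 by exists (phi (delta / 2)), (delta / 2); split=> //; lra.
have Al : has_lbound A by exists B => _ [t [t0 td ->]]; exact: HB.
have mphi t : 0 < t -> t < delta -> m <= phi t.
  by move=> t0 td; apply: (ge_inf Al); exists t.
have psiE t : 0 < t -> psi t = t + 2 * (phi t - m).
  by rewrite /psi; case: asboolP.
have psi0 : psi 0 = 0 by rewrite /psi; case: asboolP => //; rewrite ltxx.
have mono s t : 0 < s -> s <= t -> t < delta -> phi s <= phi t.
  move=> s0 st td.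
  by have := @strict_derive_growth R phi 0 delta 0 Hd s t s0 st td;
      rewrite mul0r subr_ge0.
have psider t c : 0 < t -> t < delta -> strict_derive phi t c ->
    strict_derive psi t (1 + 2 * c).
  move=> t0 td Hc.
  apply: (@strict_derive_near R (fun t =>
      t + (2 * phi t + - (2 * m))) psi 0 delta) => //.
    by move=> x x0 _; rewrite psiE//; ring.
  apply: strict_derive_add; first exact: strict_derive_id.
  rewrite -[2 * c]addr0; apply: strict_derive_add;
      first exact: strict_derive_scale.
  exact: strict_derive_cst.
have psiex t : 0 < t -> t < delta -> exists c, strict_derive psi t c.
  by move=> t0 td; have [c _ /(psider t c t0 td) Hc] := Hd t t0 td;
      exists (1 + 2 * c).
exists psi; split; last first.
  move=> t t0 td; split; last by move=>
      c /(psider t c t0 td)/strict_derive_derive1.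
    by have [c Hc] := psiex t t0 td; exact: strict_derive_derivable Hc.
  exact: (@derive1_continuous R psi t 0 delta).
split=> //.
- move=> s t; rewrite !in_itv /= => /andP[s0 sd] /andP[t0 td] st.
  have t1 : 0 < t by exact: le_lt_trans st.
  move: s0; rewrite le_eqVlt => /orP[/eqP <-|s0].
    by rewrite psi0 psiE//; have := mphi t t1 td; lra.
  by rewrite !psiE//; have := mono s t s0 (ltW st) td; lra.
- apply/subspace_continuousP => x; rewrite /= in_itv /= => /andP[x0 xd].
  move: x0; rewrite le_eqVlt => /orP[/eqP <-|x0]; last first.
    have [c /strict_derive_derivable Hc] := psiex x x0 xd.
    apply: cvg_trans (differentiable_continuous _); last exact/derivable1_diffP.
    exact/cvg_app/cvg_within.
  change (psi x @[x --> within [set` `[0, delta[] (nbhs (0 : R))] --> psi 0).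
  rewrite psi0; apply/cvgrPdist_lt => e e0; rewrite near_withinE.
  have e4 : 0 < e / 4 by lra.
  have [_ [t0 [t00 t0d ->]] Ht0] := inf_adherent e4 (conj A0 Al).
  rewrite -/m in Ht0.
  apply/nbhs_ballP; exists (Num.min t0 (e / 4)).
    by rewrite /= lt_min t00.
  move=> t; rewrite /ball /= sub0r normrN => /(le_lt_trans (ler_norm _)).
  rewrite lt_min => /andP[tt0 te]; rewrite in_itv /= => /andP[t1 td].
  rewrite sub0r normrN; move: t1; rewrite le_eqVlt => /orP[/eqP <-|t1].
    by rewrite psi0 normr0.
  rewrite psiE// ger0_norm; first by have := mono t t0 t1 (ltW tt0) t0d; lra.
  by have := mphi t t1 td; lra.
- have Hpsi : definable_fun1 O psi by rewrite /psi; definability.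
  have : definable O (fun z : 'rV[R]_(1 + 1) => (0 <= lsubmx z 0 0 /\
      lsubmx z 0 0 < delta) /\
      psi (lsubmx z 0 0) = rsubmx z 0 0) by definability.
  rewrite /definable; congr (O _); apply/seteqP; split=> z.
    move=> [[z0 zd] Ez]; exists (lsubmx z 0 0);
        first by rewrite /= in_itv /= z0.
    by rewrite Ez -!row_const hsubmxK.
  move=> [t]; rewrite /= in_itv /= => /andP[t0 td] <-.
  by rewrite row_mxKl row_mxKr !mxE !eqxx !mulr1n t0 td.
- move=> t; rewrite in_itv /= => /andP[t0 td].
  move: t0; rewrite le_eqVlt => /orP[/eqP <-|t0]; first by rewrite psi0.
  by rewrite psiE//; have := mphi t t0 td; lra.
Qed.

(** Increments of v are at least those of |v|. *)
Lemma abs_id_slope (v : R -> R) t c delta : 0 < t -> t < delta ->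
  (forall u, 0 < u -> u < delta -> `|v u| = u) -> strict_derive v t c ->
      1 <= `|c|.
Proof.
move=> t0 td Hv Hc; apply/ler_addgt0Pr => e e0; have [d [d0 Hd]] := Hc e e0.
set x := Num.min (delta - t) d / 2.
have m0 : 0 < Num.min (delta - t) d by rewrite lt_min subr_gt0 td.
have m1 : Num.min (delta - t) d <= delta - t by rewrite ge_min lexx.
have m2 : Num.min (delta - t) d <= d by rewrite ge_min lexx orbT.
have x0 : 0 < x by rewrite /x; lra.
have tx : t + x < delta by rewrite /x; lra.
have xd : x < d by rewrite /x; lra.
have E : t + x - t = x by lra.
have := Hd t (t + x); rewrite subrr normr0 E (gtr0_norm x0) => /(_ d0 xd) h.
rewrite -(ler_pM2r x0) mul1r.
have h1 : x <= `|v (t + x) - v t|.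
  apply: le_trans (lerB_dist _ _).
  by rewrite !Hv//; lra.
apply: le_trans h1 _; rewrite -(subrK (c * x) (v (t + x) - v t)).
apply: le_trans (ler_normD _ _) _; rewrite normrM (gtr0_norm x0); lra.
Qed.

End Desingularization.

(** * Curves of nearly shortest subgradients *)
Section Assembly.
Variables (R : realType) (O : forall n : nat, set (set 'rV[R]_n)).
Context {ominO : ominimal O}.
Variables (n : nat) (G : 'rV[R]_(n + 1) -> Prop) (U : 'rV[R]_n -> Prop) (B : R).
Hypotheses (HG : definable O G) (HU : definable O U) (UB : forall x, U x ->
    l1 x <= B).

(** Double orthogonality expresses that (p, -1) is in the linear span of the
    limiting normals. Unlike the Clarke subdifferential this is visibly first
    order, and the curve lemma applies to it as well. *)
Definition spanned (z : 'rV[R]_(n + 1)) (p : 'rV[R]_n) :=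
  forall zeta : 'rV[R]_(n + 1),
    (forall nu : 'rV[R]_(n + 1), limiting_normal G z nu -> dotv nu zeta = 0) ->
    dotv (row_mx p (- 1)%:M) zeta = 0.

(** The vector y is the concatenation of a point z of G, itself (x, v), and
    of p. *)
Definition slice (t : R) (y : 'rV[R]_(n + 1 + n)) :=
  U (lsubmx (lsubmx y)) /\ (G (lsubmx y) /\
  (`|rsubmx (lsubmx y) 0 0| = t /\ spanned (lsubmx y) (rsubmx y))).

(** The infimum of the norms may be 0 without being attained, in which case
    no p is within a factor 2 of it; the second alternative covers this case,
    with a bound t ^ 4 on the square small enough to be excluded later. *)
Definition nearly_minimal (t : R) (y : 'rV[R]_(n + 1 + n)) :=
  slice t y /\
  ((forall y' : 'rV[R]_(n + 1 + n), slice t y' ->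
     dotv (rsubmx y) (rsubmx y) <= 4 * dotv (rsubmx y') (rsubmx y')) \/
   dotv (rsubmx y) (rsubmx y) <= t ^+ 4).

Lemma definable_slice N (F : 'rV[R]_N -> R) (H : 'rV[R]_N ->
    'rV[R]_(n + 1 + n)) :
  definable_fun O F -> definable_map O H -> definable O (fun e =>
      slice (F e) (H e)).
Proof.
move=> HF HH; by rewrite /slice /spanned; definability => //;
    apply: definable_lnormal => //; definability.
Qed.

Lemma nearly_minimal_exists t : 0 < t -> (exists y, slice t y) ->
  exists y, nearly_minimal t y.
Proof.
move=> t0 [y0 Hy0].
pose A := [set d | exists y, slice t y /\ d = dotv (rsubmx y) (rsubmx y)].
have A0 : A !=set0 by exists (dotv (rsubmx y0) (rsubmx y0)), y0.
have Al : has_lbound A by exists 0 => _ [y [_ ->]]; exact: dotv_ge0.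
(* With infimum 0 some p has square below t ^ 4; otherwise one is below 4 times
   the infimum. *)
have [m0|m0] := leP (inf A) 0.
  have [|d [y [Hy ->]] yt] := @inf_lt R A (t ^+ 4) A0.
    by apply: le_lt_trans m0 _; exact: exprn_gt0.
  by exists y; split=> //; right; exact: ltW.
have [|d [y [Hy ->]] yt] := @inf_lt R A (4 * inf A) A0; first lra.
exists y; split=> //; left=> y' Hy'; apply: le_trans (ltW yt) _.
by rewrite ler_pM2l//; apply: (ge_inf Al); exists y'.
Qed.

(** Follow a definable curve of points of the levels |v| = t at which spanned
    vectors are nearly shortest; the derivative of phi is the l1 norm of the
    velocity of this curve. *)
Lemma talweg : exists (delta C : R) (phi : R -> R),
  [/\ 0 < delta, definable_fun1 O phi,
      forall t, 0 < t -> t < delta -> exists2 c, 0 <= c & strict_derive phi t c,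
      forall t, 0 < t -> t < delta -> C <= phi t &
      forall t y c, 0 < t -> t < delta -> slice t y -> strict_derive phi t c ->
        1 <= enorm (rsubmx y) * (1 + 2 * c)].
Proof.
have Hsl := definable_slice.
have [|Hex|[d [d0 Hd]]] := @ev_right_dec R O _ 0 (fun t => exists y, slice t y).
- by definability; apply: Hsl; definability.
- have [|V HV VP] := @choice_curve R O _ (n + 1 + n) nearly_minimal.
    by rewrite /nearly_minimal; definability; apply: Hsl; definability.
  have {}Hex : ev_right 0 (fun t => nearly_minimal t (V t)).
    by apply: ev_right_sub Hex => t t0 /(nearly_minimal_exists t0)/VP.
  have [d [d0 Hd]] := ev_right_and Hex (ev_right_lt ltr01).
  rewrite add0r in Hd.
  pose z t := lsubmx (V t); pose p t := rsubmx (V t).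
  have Hz : definable_curve O z by rewrite /z; definability.
  have Hp : definable_curve O p by rewrite /p; definability.
  have Hs i : ev_right 0 (fun t => exists c, strict_derive (fun u =>
      z u 0 i) t c).
    apply: (dense_in_ev_right ltr01); first by rewrite /strict_derive;
        definability.
    by apply: dense_in_strict_derive; definability.
  have Hkey : ev_right 0 (fun t => forall zeta nu : 'rV_(n + 1),
      velocity z t zeta ->
      limiting_normal G (z t) nu -> dotv nu zeta = 0).
    apply: (dense_in_ev_right ltr01); last exact: limiting_normal_curve.
    by rewrite /velocity /strict_derive; definability;
        apply: definable_lnormal => //; definability.
  (* Each coordinate is eventually monotone, and s is the sign of its
     derivative. *)
  have Hsig i : exists s : R, `|s| = 1 /\
      ev_right 0 (fun t => exists c, strict_derive (fun u => z u 0 i) t c /\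
          s * c = `|c|).
    have [|H|H] := @ev_right_dec R O _ 0 (fun t => exists c,
        strict_derive (fun u => z u 0 i) t c /\ 0 <= c).
    + by rewrite /strict_derive; definability.
    + exists 1; split; first exact: normr1.
      by apply: ev_right_sub H => t _ [c [Hc c0]]; exists c;
          rewrite mul1r ger0_norm.
    exists (-1); split; first by rewrite normrN normr1.
    apply: ev_right_sub (ev_right_and H (Hs i)) => t _ [nH [c Hc]]; exists c;
        split=> //.
    rewrite mulN1r ltr0_norm// ltNge; apply/negP => c0; apply: nH.
    by exists c.
  have [sig Hsig'] := choice Hsig.
  pose phi t := \sum_i sig i * z t 0 i.
  have Hphi : definable_fun1 O phi by rewrite /phi; definability.
  have HP : ev_right 0 (fun t => t < d /\ exists zeta : 'rV[R]_(n + 1),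
      strict_derive phi t (l1 zeta) /\
      1 <= enorm (p t) * l1 zeta).
    have Hsg : ev_right 0 (fun t => forall i, exists c,
        strict_derive (fun u => z u 0 i) t c /\ sig i * c = `|c|).
      by apply: ev_right_ord => i; case: (Hsig' i).
    apply: ev_right_sub (ev_right_and (ev_right_and Hkey (ev_right_lt d0)) Hsg)
        => t t0 [[Hk td] Hv]; split=> //.
    have [c Hc] := choice Hv; pose zeta := \row_i c i.
    have Hvel : velocity z t zeta by move=> i; rewrite mxE; case: (Hc i).
    exists zeta; split.
      have -> : l1 zeta = \sum_i sig i * c i.
        by apply: eq_bigr => i _; rewrite mxE; case: (Hc i).
      by apply: strict_derive_sum => i; apply: strict_derive_scale;
          case: (Hc i).
    have [[_ [_ [_ Hspan]]] _] := (Hd t t0 td).1.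
    have := Hspan zeta (fun nu => Hk zeta nu Hvel).
    rewrite -(hsubmxK zeta) (row_const (rsubmx zeta)) dotv_row dotv_scalar.
    set w := lsubmx zeta; set k := rsubmx zeta 0 0 => E.
    (* The last coordinate v of the curve satisfies |v t| = t. *)
    have k1 : 1 <= `|k|.
      apply: (@abs_id_slope R (fun u => rsubmx (z u) 0 0) t k d) => //.
        by move=> u u0 ud; have [[_ [_ [? _]]] _] := (Hd u u0 ud).1.
      have zE : (fun u => z u 0 (rshift n 0)) = (fun u => rsubmx (z u) 0 0).
        by apply/funext => u; rewrite [RHS]mxE.
      by rewrite -zE /k mxE; exact: Hvel.
    have Ek : dotv (p t) w = k by rewrite /p; lra.
    rewrite l1_row l1_scalar mulrDr; apply: le_trans k1 _.
    rewrite -[X in X <= _]addr0 -{1}Ek; apply: lerD; first exact: dotv_le_enorm.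
    by rewrite mulr_ge0// enorm_ge0.
  have [d1 [d10 Hd1]] := HP; rewrite add0r in Hd1.
  have phi_bd t : 0 < t -> t < d1 -> `|phi t| <= B + 1.
    move=> t0 td1; have [td _] := Hd1 t t0 td1.
    have [[[Uz [_ [vt _]]] _] t1] := Hd t t0 td.
    apply: (@le_trans _ _ (l1 (z t))).
      apply: le_trans (ler_norm_sum _ _ _) _; apply: ler_sum => i _.
      by rewrite normrM (Hsig' i).1 mul1r.
    rewrite -(hsubmxK (z t)) l1_row (row_const (rsubmx (z t))) l1_scalar vt.
    by apply: lerD; [exact: UB|exact: ltW].
  have B0 : 0 <= B + 1.
    by apply: le_trans (phi_bd (d1 / 2) _ _); [exact: normr_ge0|lra|lra].
  have [|[d2 [d20 Hd2]]|[d2 [d20 Hd2]]] :=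
      @ev_right_dec R O _ 0 (fun t => dotv (p t) (p t) <= t ^+ 4);
          first by definability.
    exfalso; rewrite add0r in Hd2.
    have q0 : 0 < 64 * (B + 2) by lra.
    (* If |p t| <= t ^ 2, then phi has slope at least 1 / (16 r ^ 2) on (0, 4
       r) and varies by 1 / (16 r) between r and 2 r, beyond the bound 2 (B +
       1). *)
    pose r := Num.min (Num.min d1 d2 / 8) (64 * (B + 2))^-1.
    have r0 : 0 < r.
      by rewrite lt_min invr_gt0 q0 andbT divr_gt0// lt_min d10.
    have rd1 : 4 * r < d1.
      have : r <= Num.min d1 d2 / 8 by rewrite ge_min lexx.
      have : Num.min d1 d2 <= d1 by rewrite ge_min lexx.
      lra.
    have rd2 : 4 * r < d2.
      have : r <= Num.min d1 d2 / 8 by rewrite ge_min lexx.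
      have : Num.min d1 d2 <= d2 by rewrite ge_min lexx orbT.
      lra.
    have rq : r * (64 * (B + 2)) <= 1.
      by rewrite -ler_pdivlMr// mul1r ge_min lexx orbT.
    have k0 : 0 < 16 * r ^+ 2 by rewrite mulr_gt0// exprn_gt0.
    have steep t : 0 < t -> t < 4 * r ->
        exists2 c, (16 * r ^+ 2)^-1 <= c & strict_derive phi t c.
      move=> t0 tr; have [td [zeta [Hzeta one]]] := Hd1 t t0 (lt_trans tr rd1).
      exists (l1 zeta) => //; rewrite -[X in X <= _]mul1r ler_pdivrMr//.
      apply: le_trans one _; rewrite mulrC; apply: ler_wpM2l;
          first exact: l1_ge0.
      apply: (@le_trans _ _ (t ^+ 2)).
        rewrite -(@ler_pXn2r _ 2) ?nnegrE ?enorm_ge0 ?exprn_ge0 ?(ltW t0)//.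
        by rewrite sqr_enorm -exprM; exact: (Hd2 t t0 (lt_trans tr rd2)).
      have -> : 16 * r ^+ 2 = (4 * r) ^+ 2 by rewrite exprMn; congr (_ * _);
          ring.
      have r40 : 0 <= 4 * r by lra.
      by rewrite ler_pXn2r ?nnegrE ?(ltW t0) ?(ltW tr).
    have r2r : r <= 2 * r by lra.
    have r24 : 2 * r < 4 * r by lra.
    have := strict_derive_growth steep r0 r2r r24.
    rewrite (_ : 2 * r - r = r); last by ring.
    have b1 : r < d1 by lra.
    have b2 : 2 * r < d1 by lra.
    have r20 : 0 < 2 * r by lra.
    have := phi_bd r r0 b1; have := phi_bd (2 * r) r20 b2.
    rewrite !ler_norml => /andP[_ h2] /andP[h1 _] h.
    have {}h : (16 * r ^+ 2)^-1 * r <= 2 * (B + 1) by lra.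
    have {}h : r <= 2 * (B + 1) * (16 * r ^+ 2) by rewrite -ler_pdivrMr// mulrC.
    have {}h : r * 1 <= r * (32 * (B + 1) * r) by rewrite expr2 in h; lra.
    rewrite ler_pM2l// in h; lra.
  exists (Num.min d1 d2), (- (B + 1)), phi; split=> //.
  + by rewrite lt_min d10.
  + move=> t t0; rewrite lt_min => /andP[td1 _].
    have [_ [zeta [Hzeta _]]] := Hd1 t t0 td1; exists (l1 zeta) => //.
    exact: l1_ge0.
  + move=> t t0; rewrite lt_min => /andP[td1 _].
    by have := phi_bd t t0 td1; rewrite ler_norml => /andP[].
  move=> t y c t0; rewrite lt_min => /andP[td1 td2] Hy Hc.
  have [td [zeta [Hzeta one]]] := Hd1 t t0 td1.
  rewrite (strict_derive_uniq Hc Hzeta).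
  have [[_ [Hmin|Hp4]] _] := Hd t t0 td; last first.
    by exfalso; apply: (Hd2 t t0 _ Hp4); rewrite add0r.
  have h : enorm (p t) <= 2 * enorm (rsubmx y).
    rewrite -(@ler_pXn2r _ 2) ?nnegrE ?enorm_ge0 ?mulr_ge0 ?enorm_ge0//.
    rewrite exprMn !sqr_enorm; apply: le_trans (Hmin y Hy) _.
    have -> : 2 ^+ 2 = 4 :> R by ring.
    exact: lexx.
  have h2 := ler_wpM2r (l1_ge0 zeta) h.
  have h3 := enorm_ge0 (rsubmx y); lra.
exists d, 0, (fun=> 0); split=> //.
- by definability.
- by move=> t _ _; exists 0 => //; exact: strict_derive_cst.
by move=> t y c t0 td Hy; case: (Hd t t0); [rewrite add0r|exists y].
Qed.
End Assembly.

Theorem theorem11 (R : realType) (O : forall n : nat, set (set 'rV[R]_n))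
    (ominO : ominimal O) (n : nat) (f : 'rV[R]_n -> \bar R)
    (f_gtNy : forall x, (-oo < f x)%E) (f_lsc : lsc f)
    (f_def : O (n + 1)%N (egraph f))
    (U : set 'rV[R]_n) (U_bounded : bounded_set U) (U_def : O n U) :
  exists (rho : R) (psi : R -> R), 0 < rho /\
    [/\ {in `[0, rho[ &, {homo psi : s t / s < t}},
        {within `[0, rho[, continuous psi},
        O (1 + 1)%N (graph_on `[0, rho[ psi),
        (forall t : R, t \in `[0, rho[ -> 0 <= psi t) &
        psi 0 = 0] /\
    (forall t : R, t \in `]0, rho[ ->
       derivable psi t 1 /\ {for t, continuous (derive1 psi)}) /\
    (forall x : 'rV[R]_n, U x -> (0 < `|f x| < rho%:E)%E ->
     forall p : 'rV[R]_n, clarke_subdiff f x p ->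
       derive1 psi (fine `|f x|%E) != 0 /\
       1 / derive1 psi (fine `|f x|%E) <= enorm p).
Proof.
have [B UB] : exists B, forall x, U x -> l1 x <= B.
  have [M [_ HM]] := U_bounded.
  have M1 : M < M + 1 by rewrite ltrDl.
  exists (n%:R * (M + 1)) => x Ux; apply: l1_le => i.
  apply: le_trans (HM _ M1 x Ux).
  rewrite [leRHS]/Num.norm /= mx_normrE.
  exact: (le_bigmax _ (fun ij => `|x ij.1 ij.2|) (0, i)).
have [delta [C [phi [d0 Hphi Hder HC Hkl]]]] := talweg (G :=
    egraph f) f_def U_def UB.
have [psi [Hpsi Hpsider]] := desingularize Hphi d0 Hder HC.
exists delta, psi; do 3!split=> //.
  move=> t; rewrite in_itv /= => /andP[t0 td].
  by have [] := Hpsider t t0 td.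
move=> x Ux fx p Hp; have domx := clarke_dom Hp.
have fxE := dom_fin f_gtNy domx; set v := fine (f x) in fxE.
rewrite fxE abse_EFin lte_fin lte_fin in fx *; rewrite /=; have /andP[v0 vd] :=
    fx.
have [_ _ Hd] := Hpsider _ v0 vd; have [c c0 Hc] := Hder _ v0 vd.
rewrite (Hd c Hc).
have c1 : 0 < 1 + 2 * c by lra.
split; first by rewrite gt_eqF.
rewrite ler_pdivrMr//.
have := Hkl `|v| (row_mx (row_mx x v%:M) p) c v0 vd _ Hc.
rewrite row_mxKr; apply; split; first by rewrite !row_mxKl.
split; first by rewrite row_mxKl; exists x.
rewrite /spanned !row_mxKl !row_mxKr mxE eqxx; split=> //.
exact: clarke_span.
Qed.
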